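(* Let $m=1$, let $\hat\theta\in\mathbb{R}^d$ be a nonzero prediction, let $\epsilon>0$ and $r\ge 0$, and let $B_r=\{\theta\in\mathbb{R}^d:\|\theta-\hat\theta\|_2\le r\}$. Consider testing $$H_0:\theta=0\quad\text{versus}\quad H_1:\ \|\theta\|_2\ge\epsilon\ \text{ and }\ \|\theta-\hat\theta\|_2\le r .$$ Suppose $B_r\not\subset B_\epsilon^\circ$. Then the hypotheses can be tested with nontrivial power if and only if $$n\gtrsim \rho(\epsilon,r):=\begin{cases}\sqrt d\,\epsilon^{-2} & \text{if } \mathrm{CS}(\epsilon,r)\le c\, d^{-1/4}\text{ and } S_\epsilon\cap B_r\ne\emptyset,\\ \gamma_*^{-2}(\epsilon,r) & \text{if } \mathrm{CS}(\epsilon,r)\in[c\, d^{-1/4},1]\text{ and } S_\epsilon\cap B_r\neq\emptyset,\\ \|\theta_*(r)\|_2^{-2} & \text{if } S_\epsilon\cap B_r=\emptyset,\end{cases}$$ where $c$ is a positive constant. That is, there are positive constants $c, C_1,C_2$ depending only on $\alpha$ and $\beta$ such that a valid and powerful test exists whenever $n\ge C_1\,\rho(\epsilon,r)$, and no valid test is powerful whenever $n\le C_2\,\rho(\epsilon,r)$. Furthermore, the rates depend continuously on the intersection $S_\epsilon\cap B_r$ (the expressions agree, up to multiplicative constants, at the transitions between consecutive cases), and they are ordered from worst (largest) to best (smallest), up to multiplicative constants, from top to bottom.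
   Context: $d,n\ge1$ are integers. One observes $X\sim P_\theta=\mathcal N(\theta,I_d/n)$ (the mean of $n$ i.i.d. $\mathcal N(\theta,I_d)$ observations) with unknown $\theta\in\mathbb{R}^d$; $\hat\theta$ is fixed (non-random). Fix $\alpha\in(0,1)$ and $\beta\in(0,1-\alpha)$. A test is a measurable $\psi:\mathbb{R}^d\to\{0,1\}$ (here it may depend on $d,n,\hat\theta,\epsilon,r,\alpha$); it is valid if $P_0(\psi(X)=1)\le\alpha$. A valid test is powerful if $\sup P_\theta(\psi(X)=0)<\beta$, the supremum being over all $\theta$ in the alternative $H_1$. ''Can be tested with nontrivial power'' means that a valid and powerful test exists. $S_\epsilon=\{\theta\in\mathbb{R}^d:\|\theta\|_2=\epsilon\}$, $B_\epsilon^\circ=\{\theta:\|\theta\|_2<\epsilon\}$. $\Pi_{\hat U}$ is the orthogonal projection onto the line spanned by $\hat\theta$. $\gamma_*(\epsilon,r)\ge0$ is defined by $\gamma_*^2(\epsilon,r)=\inf_{\theta\in S_\epsilon\cap B_r}\|\Pi_{\hat U}\theta\|_2^2$. $\mathrm{CS}(\epsilon,r)=\inf_{\theta\in S_\epsilon\cap B_r}\mathrm{CS}(\Pi_{\hat U}\theta,\theta)=\gamma_*(\epsilon,r)/\epsilon$ when $S_\epsilon\cap B_r\ne\emptyset$, where the cosine similarity of two vectors is $\mathrm{CS}(a,b)=\langle a,b\rangle/(\|a\|_2\|b\|_2)$ if both are nonzero, and $0$ otherwise. $\theta_*(r)=\arg\inf_{\theta\in B_r}\|\theta\|_2^2$ is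 the unique point of $B_r$ of smallest norm. *)

(* Defs.v *)
From HB Require Import structures.
From mathcomp Require Import all_boot all_order all_algebra.
From mathcomp Require Import ring lra.
From mathcomp Require Import all_classical all_reals all_analysis.

Set Implicit Arguments.
Unset Strict Implicit.
Unset Printing Implicit Defensive.

Import Order.TTheory GRing.Theory Num.Theory.
Import numFieldNormedType.Exports.

Local Open Scope classical_set_scope.
Local Open Scope ring_scope.

(* The sigma-algebra on row vectors is the one generated by the coordinates;
   on 'rV[R]_d this is the Borel sigma-algebra of R^d. *)
Definition measure_rV_display : measure_display -> measure_display.
Proof. exact. Qed.

Section measurable_rV.
Context {disp : measure_display} {T : sigmaRingType disp} (d : nat).

Let coord : 'I_d -> 'rV[T]_d -> T := fun i x => x ord0 i.

Let rV_set0 : g_sigma_preimage coord set0.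
Proof. exact: sigma_algebra0. Qed.

Let rV_setC A : g_sigma_preimage coord A -> g_sigma_preimage coord (~` A).
Proof. exact: sigma_algebraC. Qed.

Let rV_bigcup (F : (set 'rV[T]_d)^nat) :
  (forall i, g_sigma_preimage coord (F i)) ->
  g_sigma_preimage coord (\bigcup_i (F i)).
Proof. exact: sigma_algebra_bigcup. Qed.

HB.instance Definition _ := @isMeasurable.Build (measure_rV_display disp)
  'rV[T]_d (g_sigma_preimage coord) rV_set0 rV_setC rV_bigcup.

End measurable_rV.

Lemma measurable_coord disp (T : sigmaRingType disp) d (i : 'I_d) :
  measurable_fun [set: 'rV[T]_d] (fun x : 'rV[T]_d => x ord0 i).
Proof.
move=> _ Y mY; rewrite setTI; apply: sub_sigma_algebra => /=.
rewrite -bigcup_seq/=; exists i => /=; first by rewrite mem_index_enum.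
by exists Y => //; rewrite setTI.
Qed.

Lemma measurable_fun_rV disp1 disp2 (T1 : measurableType disp1)
    (T2 : measurableType disp2) d (f : T1 -> 'rV[T2]_d) :
  (forall i, measurable_fun [set: T1] (fun x => f x ord0 i)) ->
  measurable_fun [set: T1] f.
Proof.
move=> mf.
suff H : g_sigma_preimage (fun i => (fun x : 'rV[T2]_d => x ord0 i) \o f)
    `<=` measurable.
  move=> _ A mA; apply: H; rewrite g_sigma_preimage_comp.
  by exists A.
apply: smallest_sub; first exact: sigma_algebra_measurable.
rewrite -bigcup_seq => A [i /= _ [B mB <-]]; exact: mf.
Qed.

Section gaussian_law.
Context {R : realType}.

Definition rV_cons d (xy : measurableTypeR R * 'rV[R]_d) : 'rV[R]_d.+1 :=
  row_mx (const_mx xy.1 : 'rV_1) xy.2.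

Lemma rV_cons0 d xy : @rV_cons d xy ord0 ord0 = xy.1.
Proof.
by rewrite mxE; case: splitP => j //= _; rewrite mxE.
Qed.

Lemma rV_consS d xy (i : 'I_d) : @rV_cons d xy ord0 (lift ord0 i) = xy.2 ord0 i.
Proof.
rewrite mxE; case: splitP => j /=; first by rewrite ord1.
by rewrite /bump add1n => -[] /val_inj ->.
Qed.

Lemma measurable_rV_cons d : measurable_fun setT (@rV_cons d).
Proof.
apply: measurable_fun_rV => i; case: (unliftP ord0 i) => [j ->|->].
  rewrite (_ : (fun _ => _) = (fun y : 'rV[R]_d => y ord0 j) \o snd).
    exact: measurableT_comp (measurable_coord _) measurable_snd.
  by apply/funext => xy /=; rewrite rV_consS.
rewrite (_ : (fun _ => _) = fst); first exact: measurable_fst.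
by apply/funext => xy; rewrite rV_cons0.
Qed.

HB.instance Definition _ d :=
  @isMeasurableFun.Build _ _ _ _ (@rV_cons d) (@measurable_rV_cons d).

(* N(theta, s^2 I_d), i.e. the product of the N(theta_i, s^2), i < d. *)
Fixpoint gaussian_rV (s : R) d : 'rV[R]_d -> probability 'rV[R]_d R :=
  match d with
  | 0 => fun _ => \d_(0 : 'rV[R]_0)
  | d'.+1 => fun theta : 'rV[R]_(1 + d') =>
      distribution (normal_prob (theta ord0 ord0) s \x
                    gaussian_rV s (rsubmx theta))%E (@rV_cons d')
  end.

Lemma gaussian_rV_rect (s : R) d (theta : 'rV[R]_d) (A : 'I_d -> set R) :
  (forall i, measurable (A i)) ->
  gaussian_rV s theta [set x : 'rV[R]_d | forall i, A i (x ord0 i)] =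
  (\prod_(i < d) normal_prob (theta ord0 i) s (A i))%E.
Proof.
elim: d theta A => [|d IH] theta A mA.
  rewrite big_ord0 (_ : mkset _ = setT) ?probability_setT //.
  by apply/seteqP; split => // x _ /= [].
rewrite big_ord_recl /= /distribution /pushforward.
pose B := [set x : 'rV[R]_d | forall i, A (lift ord0 i) (x ord0 i)].
have mB : measurable B.
  rewrite (_ : B = \bigcap_(i in [set: 'I_d])
    ((fun x : 'rV[R]_d => x ord0 i) @^-1` A (lift ord0 i))).
    apply: fin_bigcap_measurable => // i _; rewrite -[X in measurable X]setTI.
    exact: measurable_coord.
  by apply/seteqP; split => x /= h i; [move=> _|]; exact: h.
rewrite (_ : _ @^-1` _ = A ord0 `*` B); last first.
  apply/seteqP; split => -[x y] /=.
    move=> h; split; first by have := h ord0; rewrite rV_cons0.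
    by move=> i; have := h (lift ord0 i); rewrite rV_consS.
  move=> [/= hx hy] i; case: (unliftP ord0 i) => [j ->|->].
    by rewrite rV_consS; exact: hy.
  by rewrite rV_cons0.
rewrite [LHS]product_measure1E //; last exact: (mA ord0).
congr (_ * _)%E.
pose th : 'rV[R]_d := rsubmx (theta : 'rV_(1 + d)).
rewrite [LHS](IH th (fun i => A (lift ord0 i))) //; apply: eq_bigr => i _.
rewrite mxE; congr (normal_prob (theta _ _) _ _); exact/val_inj.
Qed.

End gaussian_law.

Section testing_problem.
Context {R : realType}.
Implicit Types (d n : nat) (c alpha beta eps r : R).

Definition dot d (u v : 'rV[R]_d) : R := \sum_i u ord0 i * v ord0 i.

(* The Euclidean norm; the library norm on 'rV[R]_d is the sup norm. *)
Definition norm2 d (u : 'rV[R]_d) : R := Num.sqrt (dot u u).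

Definition proj_line d (that theta : 'rV[R]_d) : 'rV[R]_d :=
  (dot theta that / dot that that) *: that.

Definition cos_sim d (a b : 'rV[R]_d) : R :=
  if (a != 0) && (b != 0) then dot a b / (norm2 a * norm2 b) else 0.

Definition sphere2 d eps : set 'rV[R]_d := [set theta | norm2 theta = eps].

Definition oball2 d eps : set 'rV[R]_d := [set theta | norm2 theta < eps].

Definition pred_ball d (that : 'rV[R]_d) r : set 'rV[R]_d :=
  [set theta | norm2 (theta - that) <= r].

Definition cap d (that : 'rV[R]_d) eps r : set 'rV[R]_d :=
  sphere2 eps `&` pred_ball that r.

Definition gamma_star d (that : 'rV[R]_d) eps r : R :=
  Num.sqrt (inf [set norm2 (proj_line that theta) ^+ 2
                | theta in cap that eps r]).

Definition CS d (that : 'rV[R]_d) eps r : R :=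
  inf [set cos_sim (proj_line that theta) theta | theta in cap that eps r].

(* [get] selects the point of minimal norm, which exists and is unique when
   0 <= r because pred_ball is then nonempty, compact and convex. *)
Definition theta_star d (that : 'rV[R]_d) r : 'rV[R]_d :=
  get [set theta | pred_ball that r theta /\
    forall theta', pred_ball that r theta' ->
      norm2 theta ^+ 2 <= norm2 theta' ^+ 2].

(* The law of the mean of n i.i.d. N(theta, I_d) observations. *)
Definition law n d (theta : 'rV[R]_d) : probability 'rV[R]_d R :=
  gaussian_rV (Num.sqrt n%:R)^-1 theta.

Definition H1 d (that : 'rV[R]_d) eps r : set 'rV[R]_d :=
  [set theta | eps <= norm2 theta /\ norm2 (theta - that) <= r].

Definition valid alpha n d (psi : {mfun 'rV[R]_d >-> bool}) : Prop :=
  (law n (0 : 'rV[R]_d) [set x | psi x = true] <= alpha%:E)%E.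

Definition powerful beta n d (that : 'rV[R]_d) eps r
    (psi : {mfun 'rV[R]_d >-> bool}) : Prop :=
  (ereal_sup [set law n theta [set x | psi x = false]
             | theta in H1 that eps r] < beta%:E)%E.

Definition admissible d (that : 'rV[R]_d) eps r : Prop :=
  [/\ that != 0, 0 < eps, 0 <= r & ~ (pred_ball that r `<=` oball2 eps)].

(* The three lines of the case distinction defining rho, from top to bottom. *)
Inductive regime := Diffuse | Aligned | Separated.

Definition in_regime c (k : regime) d (that : 'rV[R]_d) eps r : Prop :=
  let t := c * d%:R `^ (- 4^-1) in
  admissible that eps r /\
  match k with
  | Diffuse => CS that eps r <= t /\ cap that eps r !=set0
  | Aligned => t <= CS that eps r <= 1 /\ cap that eps r !=set0
  | Separated => cap that eps r = set0
  end.

Definition rate (k : regime) d (that : 'rV[R]_d) eps r : R :=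
  match k with
  | Diffuse => Num.sqrt d%:R * eps ^- 2
  | Aligned => gamma_star that eps r ^- 2
  | Separated => norm2 (theta_star that r) ^- 2
  end.

(* rho is a relation because the first two regimes overlap when CS equals the
   threshold, where both expressions are then admitted. *)
Definition is_rho c d (that : 'rV[R]_d) eps r (rho : R) : Prop :=
  exists2 k, in_regime c k that eps r & rho = rate k that eps r.

Definition regime_set c (k : regime) d : set ('rV[R]_d * R * R) :=
  [set p | in_regime c k p.1.1 p.1.2 p.2].

Lemma dot_ge0 d (u : 'rV[R]_d) : 0 <= dot u u.
Proof. by apply: sumr_ge0 => i _; rewrite -expr2 sqr_ge0. Qed.

Lemma dot_Cauchy_Schwarz d (u v : 'rV[R]_d) : dot u v <= norm2 u * norm2 v.
Proof.
suff H : dot u v ^+ 2 <= dot u u * dot v v.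
  rewrite /norm2 -sqrtrM ?dot_ge0 //; apply: le_trans (ler_norm _) _.
  by rewrite -sqrtr_sqr ler_wsqrtr.
have E x : dot (x *: u + v) (x *: u + v) =
    x ^+ 2 * dot u u + x * dot u v *+ 2 + dot v v.
  rewrite /dot !mulr_sumr -sumrMnl -!big_split /=; apply: eq_bigr => i _.
  by rewrite !mxE; ring.
have H x : 0 <= x ^+ 2 * dot u u + x * dot u v *+ 2 + dot v v.
  by rewrite -E dot_ge0.
have := dot_ge0 u; rewrite le_eqVlt => /predU1P[u0|u0].
  rewrite -u0 mul0r; have {}H x : 0 <= x * dot u v *+ 2 + dot v v.
    by have := H x; rewrite -u0 mulr0 add0r.
  have [->|uv0] := eqVneq (dot u v) 0; first by rewrite expr0n.
  have := H (- (dot v v + 1) / dot u v); rewrite mulfVK // mulr2n.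
  by have := dot_ge0 v; lra.
have := H (- dot u v / dot u u).
have -> : (- dot u v / dot u u) ^+ 2 * dot u u +
    - dot u v / dot u u * dot u v *+ 2 + dot v v =
    (dot u u * dot v v - dot u v ^+ 2) / dot u u.
  by field; rewrite gt_eqF.
by rewrite pmulr_lge0 ?invr_gt0 // subr_ge0.
Qed.

Lemma cos_sim_le1 d (a b : 'rV[R]_d) : cos_sim a b <= 1.
Proof.
rewrite /cos_sim; case: ifP => // _; have := dot_Cauchy_Schwarz a b.
have : 0 <= norm2 a * norm2 b by rewrite mulr_ge0 ?sqrtr_ge0.
rewrite le_eqVlt => /predU1P[<- _|p]; first by rewrite invr0 mulr0.
by rewrite ler_pdivrMr // mul1r.
Qed.

Lemma cos_sim_proj_ge0 d (that theta : 'rV[R]_d) :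
  0 <= cos_sim (proj_line that theta) theta.
Proof.
rewrite /cos_sim; case: ifP => // _.
apply: divr_ge0; last by rewrite mulr_ge0 ?sqrtr_ge0.
have -> : dot (proj_line that theta) theta =
    dot theta that ^+ 2 / dot that that.
  rewrite expr2 mulrAC [in RHS]mulrC {1 4}/dot mulr_suml.
  by apply: eq_bigr => i _; rewrite !mxE; ring.
by rewrite divr_ge0 ?sqr_ge0 ?dot_ge0.
Qed.

Lemma is_rho_total c d (that : 'rV[R]_d) eps r :
  admissible that eps r -> exists rho, is_rho c that eps r rho.
Proof.
move=> adm; have [S0|/set0P S0] := eqVneq (cap that eps r) set0.
  by exists (rate Separated that eps r), Separated.
have [le|/ltW ge] := leP (CS that eps r) (c * d%:R `^ (- 4^-1)).
  by exists (rate Diffuse that eps r), Diffuse.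
exists (rate Aligned that eps r), Aligned => //; split=> //; split=> //.
rewrite ge /=; have [theta Stheta] := S0.
apply: le_trans (cos_sim_le1 (proj_line that theta) theta).
apply: ge_inf; last by exists theta.
by exists 0 => _ [x _ <-]; exact: cos_sim_proj_ge0.
Qed.

(* Parameters at the transition between the regimes k and k'. *)
Definition transition c (k k' : regime) d (that : 'rV[R]_d) eps r : Prop :=
  admissible that eps r /\
  (closure (regime_set c k (d:=d)) `&` closure (regime_set c k' (d:=d)))
    (that, eps, r).

End testing_problem.

(* Main.v *)
Require Import Defs.
From HB Require Import structures.
From mathcomp Require Import all_boot all_order all_algebra.
From mathcomp Require Import ring lra.
From mathcomp Require Import all_classical all_reals all_analysis.
From mathcomp Require Import measurable_realfun.

Set Implicit Arguments.
Unset Strict Implicit.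
Unset Printing Implicit Defensive.

Import Order.TTheory GRing.Theory Num.Theory.
Import numFieldNormedType.Exports.

Local Open Scope classical_set_scope.
Local Open Scope ring_scope.

(** Everything rests on exponential integrals of Gaussian laws, which factor over
    the coordinates by Tonelli, and on the shape of the alternative.  Write [u] for
    the unit vector along the prediction, and [N] for the norm of the prediction.

    Geometry.  A point of norm [eps] lies in the prediction ball exactly when its
    component along [u] is at least the height
    [(N ^+ 2 + eps ^+ 2 - r ^+ 2) / (2 * N)].  The sphere meets the ball exactly
    when this height is at most [eps].  In that case [gamma_star] is the positive
    part of the height in dimension at least two, and [eps] in dimension one, where
    projecting changes nothing; [CS] is [gamma_star / eps] ([gamma_starE], [CSE]).
    Otherwise the whole ball lies outside the sphere, and its point of smallest
    norm is [(N - r) *: u] ([separatedE], [norm2_theta_star]).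

    Sufficiency.  Rejecting for large values of the component of the observation
    along [u], in absolute value, detects every alternative whose component along
    [u] is at least a multiple of [(sqrt n)^-1]; all alternatives have component at
    least [gamma_star], respectively [N - r], in absolute value.  Rejecting for large
    values of the squared norm of the observation detects every alternative whose
    squared norm is at least a multiple of [sqrt d / n].  Both error bounds are
    Chernoff bounds ([linear_test], [quadratic_test]).

    Necessity.  If the alternative contains points [theta i] such that the mean over
    [i] and [j] of [expR (n * dot (theta i) (theta j))] is close to one, then the
    mixture of their laws is close to the null law in chi-square distance, hence in
    total variation, and no test is powerful ([not_powerful]).  When the sphere
    misses the ball, the point of smallest norm alone suffices.  When it meets the
    ball in dimension at least two, one takes the points of the cap with component
    [gamma_star] along [u] whose remaining part is a random sign combination of an
    orthonormal basis of the orthogonal complement: the mean is then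
    [expR (n * gamma_star ^+ 2)] times a power of a hyperbolic cosine, and it is
    close to one as soon as [n * gamma_star ^+ 2] and [n * eps ^+ 2 / sqrt d] are
    small ([not_powerful_cap]).  These are the two rates, compared through the
    threshold on [CS].

    Transitions and order.  Up to the positive factor [2 * N], the conditions that
    describe the regimes are inequalities between continuous functions of the
    prediction, [eps] and [r], so they pass to closures; at a transition they force
    equality, and the two rates then agree up to the factor four. *)

(** * Euclidean geometry of row vectors *)

Section euclidean.
Context {R : realType}.

Lemma dotC d (u v : 'rV[R]_d) : dot u v = dot v u.
Proof. by apply: eq_bigr => i _; rewrite mulrC. Qed.

Lemma dotDl d (u v w : 'rV[R]_d) : dot (u + v) w = dot u w + dot v w.
Proof.
by rewrite /dot -big_split/=; apply: eq_bigr => i _; rewrite mxE mulrDl.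
Qed.

Lemma dotZl d a (u v : 'rV[R]_d) : dot (a *: u) v = a * dot u v.
Proof. by rewrite /dot mulr_sumr; apply: eq_bigr => i _; rewrite mxE mulrA. Qed.

Lemma dotDr d (u v w : 'rV[R]_d) : dot u (v + w) = dot u v + dot u w.
Proof. by rewrite dotC dotDl !(dotC u). Qed.

Lemma dotZr d a (u v : 'rV[R]_d) : dot u (a *: v) = a * dot u v.
Proof. by rewrite dotC dotZl dotC. Qed.

Lemma dot_recl d (u v : 'rV[R]_(1 + d)) :
  dot u v = u ord0 ord0 * v ord0 ord0 + dot (rsubmx u) (rsubmx v).
Proof.
rewrite /dot big_ord_recl; congr (_ + _); apply: eq_bigr => i _.
by rewrite !mxE; congr (u _ _ * v _ _); exact/val_inj.
Qed.

Lemma dotNr d (u v : 'rV[R]_d) : dot u (- v) = - dot u v.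
Proof. by rewrite -scaleN1r dotZr mulN1r. Qed.

Lemma dotBr d (u v w : 'rV[R]_d) : dot u (v - w) = dot u v - dot u w.
Proof. by rewrite dotDr dotNr. Qed.

Lemma dotBl d (u v w : 'rV[R]_d) : dot (u - v) w = dot u w - dot v w.
Proof. by rewrite dotC dotBr !(dotC w). Qed.

Lemma dot0r d (u : 'rV[R]_d) : dot u 0 = 0.
Proof. by rewrite -(scale0r u) dotZr mul0r. Qed.

Lemma dot_eq0 d (u : 'rV[R]_d) : (dot u u == 0) = (u == 0).
Proof.
apply/idP/eqP => [|->]; last by rewrite dot0r.
rewrite psumr_eq0 => [/allP u0|i _]; last by rewrite -expr2 sqr_ge0.
apply/rowP => i; rewrite mxE; apply/eqP.
by have := u0 i; rewrite mem_index_enum mulf_eq0 orbb => /(_ isT).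
Qed.

Lemma norm2_ge0 d (u : 'rV[R]_d) : 0 <= norm2 u.
Proof. exact: sqrtr_ge0. Qed.

Lemma norm2_sqr d (u : 'rV[R]_d) : norm2 u ^+ 2 = dot u u.
Proof. by rewrite sqr_sqrtr ?dot_ge0. Qed.

Lemma norm2_gt0 d (u : 'rV[R]_d) : (0 < norm2 u) = (u != 0).
Proof. by rewrite sqrtr_gt0 lt0r dot_ge0 andbT dot_eq0. Qed.

Lemma norm2Z d a (u : 'rV[R]_d) : norm2 (a *: u) = `|a| * norm2 u.
Proof.
by rewrite /norm2 dotZl dotZr mulrA -expr2 sqrtrM ?sqr_ge0// sqrtr_sqr.
Qed.

Lemma norm2N d (u : 'rV[R]_d) : norm2 (- u) = norm2 u.
Proof. by rewrite -scaleN1r norm2Z normrN1 mul1r. Qed.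

Lemma norm2_triangle d (u v : 'rV[R]_d) : norm2 (u + v) <= norm2 u + norm2 v.
Proof.
rewrite -[leRHS]ger0_norm ?addr_ge0 ?norm2_ge0//.
rewrite -[leLHS]ger0_norm ?norm2_ge0// -ler_sqr ?nnegrE ?normr_ge0//.
rewrite !real_normK ?num_real// sqrrD !norm2_sqr !dotDl !dotDr (dotC v u).
have := dot_Cauchy_Schwarz u v; lra.
Qed.

(** The Householder reflection along [a - b] exchanges [a] and [b]; division by
    zero being zero, the same formula is the identity when [a = b]. *)
Lemma reflection d (a b : 'rV[R]_d) : dot a a = dot b b ->
  exists H : 'rV[R]_d -> 'rV[R]_d,
    H a = b /\ forall x y, dot (H x) (H y) = dot x y.
Proof.
move=> ab; have [w wE] : exists w, w = a - b by exists (a - b).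
exists (fun x => x - (2 * dot w x / dot w w) *: w).
have [w0|w0] := eqVneq (dot w w) 0.
  have {}w0 : w = 0 by apply/eqP; rewrite -dot_eq0 w0.
  split; last by move=> x y; rewrite w0 !scaler0 !subr0.
  by rewrite w0 scaler0 subr0; apply/eqP; rewrite -subr_eq0 -wE w0.
split.
  rewrite (_ : 2 * dot w a / dot w w = 1); first by rewrite scale1r wE subKr.
  have -> : 2 * dot w a = dot w w.
    by rewrite wE !dotBl !dotBr (dotC b a) ab; ring.
  by rewrite divff.
move=> x y; rewrite !dotBl !dotBr !dotZl !dotZr (dotC x w); field.
exact: w0.
Qed.

(** The vertices of a hypercube in the hyperplane orthogonal to the first basis
    vector, carried to the hyperplane orthogonal to [u] by a reflection.  Only their
    inner products matter later, so no basis of that hyperplane is needed. *)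
Lemma sign_frame d (u : 'rV[R]_d.+1) : dot u u = 1 ->
  exists v : {ffun 'I_d -> bool} -> 'rV[R]_d.+1,
    (forall f, dot u (v f) = 0) /\
    forall f g, dot (v f) (v g) = \sum_i (-1) ^+ f i * (-1) ^+ g i.
Proof.
move=> u1; pose e : 'rV[R]_d.+1 := delta_mx 0 0.
have eE (y : 'rV[R]_d.+1) : dot e y = y 0 0.
  rewrite /dot big_ord_recl big1 ?addr0 => [|i _]; first by rewrite mxE !eqxx mul1r.
  by rewrite mxE /= mul0r.
have [H [He HH]] : exists H : 'rV[R]_d.+1 -> 'rV[R]_d.+1,
    H e = u /\ forall x y, dot (H x) (H y) = dot x y.
  by apply: reflection; rewrite eE mxE !eqxx u1.
pose y (f : {ffun 'I_d -> bool}) : 'rV[R]_d.+1 :=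
  \row_j if unlift ord0 j is Some i then (-1) ^+ f i else 0.
exists (fun f => H (y f)); split=> [f|f g].
  by rewrite -He HH eE mxE unlift_none.
rewrite HH /dot big_ord_recl !mxE unlift_none mul0r add0r.
by apply: eq_bigr => i _; rewrite !mxE liftK.
Qed.

Lemma sum_signs d (f : {ffun 'I_d -> bool}) :
  \sum_i (-1) ^+ f i * (-1) ^+ f i = d%:R :> R.
Proof.
rewrite (eq_bigr (fun=> 1)) ?sumr_const ?card_ord// => i _.
by case: (f i); rewrite ?expr1 ?expr0 ?mulr1 ?mulrNN ?mulr1.
Qed.

End euclidean.

(** * One-dimensional Gaussian integrals *)

Section gaussian_integrals.
Context {R : realType}.
Implicit Types (m s q : R).
Local Notation mu := (@lebesgue_measure R).

(** The density is almost everywhere the Radon-Nikodym derivative, because both have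
    the same integral over every measurable set. *)
Lemma integral_normal_prob m s (f : measurableTypeR R -> \bar R) :
  measurable_fun setT f -> (forall x, 0 <= f x)%E ->
  (\int[normal_prob m s]_x f x = \int[mu]_x (f x * (normal_pdf m s x)%:E))%E.
Proof.
move=> mf f0; have dom := normal_prob_dominates m s.
have mpdf : measurable_fun setT (fun x => (normal_pdf m s x)%:E).
  by apply/measurable_EFinP; exact: measurable_normal_pdf.
rewrite -(Radon_Nikodym_SigmaFinite.change_of_variables dom)//.
have iRN := Radon_Nikodym_SigmaFinite.f_integrable dom.
have mRN := measurable_int _ iRN.
apply: ge0_ae_eq_integral => //.
- exact: emeasurable_funM.
- exact: emeasurable_funM.
- by move=> x _; rewrite mule_ge0 ?Radon_Nikodym_SigmaFinite.f_ge0.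
- by move=> x _; rewrite mule_ge0 ?lee_fin ?normal_pdf_ge0.
- apply: ae_eqe_mul2l; apply: integral_ae_eq => // E _ mE.
  by rewrite -Radon_Nikodym_SigmaFinite.f_integral.
Qed.

Lemma normal_prob_shift m s (f : measurableTypeR R -> \bar R) : s != 0 ->
  measurable_fun setT f -> (forall x, 0 <= f x)%E ->
  (\int[normal_prob m s]_x f x =
   \int[normal_prob 0 s]_x
     (f x * (expR (m * x / s ^+ 2 - m ^+ 2 / (s ^+ 2 *+ 2)))%:E))%E.
Proof.
move=> s0 mf f0; rewrite !integral_normal_prob//; first last.
- by move=> x; rewrite mule_ge0// lee_fin expR_ge0.
- apply: emeasurable_funM => //; apply/measurable_EFinP.
  apply: measurableT_comp => //; apply: measurable_funB => //.
  by apply: measurable_funM => //; exact: measurable_funM.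
apply: eq_integral => x _; rewrite -muleA -EFinM; congr (_ * _%:E)%E.
rewrite !normal_pdfE// mulrCA /normal_fun -expRD; congr (_ * expR _).
by field.
Qed.

(** Completing the square turns the integrand into a multiple of the density of mean
    [m / w] and variance [s ^+ 2 / w], with [w := 1 + 2 * q * s ^+ 2].  Negative [q]
    is what the upper tail of a squared norm requires. *)
Lemma integral_normal_prob_expR_sqr m s q : s != 0 -> 0 < 1 + 2 * q * s ^+ 2 ->
  (\int[normal_prob m s]_x (expR (- (q * x ^+ 2)))%:E =
   ((Num.sqrt (1 + 2 * q * s ^+ 2))^-1 *
     expR (- (q * m ^+ 2 / (1 + 2 * q * s ^+ 2))))%:E)%E.
Proof.
move=> s0; set w := 1 + _ => w0.
have sw0 : Num.sqrt w != 0 by rewrite gt_eqF// sqrtr_gt0.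
rewrite integral_normal_prob; first last.
- by move=> x; rewrite lee_fin expR_ge0.
- apply/measurable_EFinP; apply: measurableT_comp => //.
  by apply: measurableT_comp => //; apply: measurable_funM.
pose C := (Num.sqrt w)^-1 * expR (- (q * m ^+ 2 / w)).
transitivity (\int[mu]_x (C%:E * (normal_pdf (m / w) (s / Num.sqrt w) x)%:E))%E.
  apply: eq_integral => x _; rewrite -!EFinM; congr _%:E.
  rewrite !normal_pdfE ?mulf_neq0 ?invr_eq0// /C.
  have -> : normal_peak (s / Num.sqrt w) = Num.sqrt w * normal_peak s.
    rewrite /normal_peak expr_div_n sqr_sqrtr ?ltW//.
    have E p : s ^+ 2 / w * p *+ 2 = w^-1 * (s ^+ 2 * p *+ 2) by ring.
    by rewrite E sqrtrM ?invr_ge0 ?ltW// sqrtrV ?ltW// invfM invrK.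
  rewrite [RHS](_ : _ = normal_peak s * (expR (- (q * m ^+ 2 / w)) *
    normal_fun (m / w) (s / Num.sqrt w) x)); last by field.
  rewrite mulrCA; congr (_ * _).
  rewrite /normal_fun -!expRD expr_div_n sqr_sqrtr ?ltW//; congr expR.
  by rewrite /w; field; rewrite -/w s0 gt_eqF.
rewrite ge0_integralZl//; first last.
- by rewrite lee_fin mulr_ge0 ?invr_ge0 ?sqrtr_ge0 ?expR_ge0.
- by move=> x _; rewrite lee_fin normal_pdf_ge0.
- by apply/measurable_EFinP; exact: measurable_normal_pdf.
by rewrite integral_normal_pdf mule1.
Qed.

Lemma measurable_dot d (w : 'rV[R]_d) : measurable_fun setT (dot w).
Proof.
apply: measurable_sum => i; apply: measurable_funM => //.
exact: measurable_coord.
Qed.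

Lemma measurable_dotxx d : measurable_fun setT (fun x : 'rV[R]_d => dot x x).
Proof.
by apply: measurable_sum => i; apply: measurable_funM => //;
  exact: measurable_coord.
Qed.

Lemma rsubmx_rV_cons d (xy : measurableTypeR R * 'rV[R]_d) :
  rsubmx (rV_cons xy : 'rV_(1 + d)) = xy.2.
Proof. by rewrite /rV_cons row_mxKr. Qed.

(** Tonelli for one coordinate, the step of every induction on the dimension. *)
Lemma integral_gaussian_rVS s d (theta : 'rV[R]_d.+1) (f : 'rV[R]_d.+1 -> \bar R) :
  measurable_fun setT f -> (forall x, 0 <= f x)%E ->
  (\int[gaussian_rV s theta]_x f x = \int[normal_prob (theta ord0 ord0) s]_x
    \int[gaussian_rV s (rsubmx (theta : 'rV_(1 + d)))]_y f (rV_cons (x, y)))%E.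
Proof.
move=> mf f0 /=; rewrite ge0_integral_distribution//.
rewrite fubini_tonelli1//; last by move=> x; exact: f0.
by apply: measurableT_comp => //; exact: measurable_rV_cons.
Qed.

End gaussian_integrals.

(** * Likelihood ratios and exponential moments *)

Section likelihood_ratios.
Context {R : realType}.
Implicit Types (m s q : R).

Lemma measurable_expR_dot d (w : 'rV[R]_d) (b : R) :
  measurable_fun setT (fun x : 'rV[R]_d => expR (dot w x - b)).
Proof.
apply: measurableT_comp => //; apply: measurable_funB => //.
exact: measurable_dot.
Qed.

Lemma gaussian_rV0 s (theta : 'rV[R]_0) (f : 'rV[R]_0 -> \bar R) :
  measurable_fun setT f -> (\int[gaussian_rV s theta]_x f x = f (0 : 'rV_0)%R)%E.
Proof. by move=> mf /=; rewrite integral_dirac// diracT mul1e. Qed.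

(* Unification would otherwise unfold the recursive definition of the law. *)
Local Opaque gaussian_rV.

(** The density of N(theta, s^2 I) with respect to N(0, s^2 I). *)
Definition likelihood s d (theta x : 'rV[R]_d) : R :=
  expR (dot (s ^- 2 *: theta) x - dot theta theta / (s ^+ 2 *+ 2)).

Lemma likelihood_recl s d (theta x : 'rV[R]_(1 + d)) :
  likelihood s theta x =
    expR (theta ord0 ord0 * x ord0 ord0 / s ^+ 2 -
          theta ord0 ord0 ^+ 2 / (s ^+ 2 *+ 2)) *
    likelihood s (rsubmx theta) (rsubmx x).
Proof.
rewrite /likelihood -expRD !dot_recl linearZ/= !mxE; congr expR.
by rewrite !mulrDl opprD; ring.
Qed.

Lemma measurable_likelihood s d (theta : 'rV[R]_d) :
  measurable_fun setT (likelihood s theta).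
Proof. exact: measurable_expR_dot. Qed.

Lemma likelihood_ge0 s d (theta x : 'rV[R]_d) : 0 <= likelihood s theta x.
Proof. exact: expR_ge0. Qed.

Lemma integral_gaussian_rV_likelihood s d (theta : 'rV[R]_d)
    (f : 'rV[R]_d -> \bar R) :
  s != 0 -> measurable_fun setT f -> (forall x, 0 <= f x)%E ->
  (\int[gaussian_rV s theta]_x f x =
   \int[gaussian_rV s (0 : 'rV[R]_d)]_x (f x * (likelihood s theta x)%:E))%E.
Proof.
move=> s0; elim: d theta f => [|d IH] theta f mf f0.
  rewrite !gaussian_rV0//; last first.
    apply: emeasurable_funM => //; apply/measurable_EFinP.
    exact: measurable_likelihood.
  by rewrite /likelihood /dot !big_ord0 mul0r subrr expR0 mule1.
have mfl : measurable_fun setT (fun x => f x * (likelihood s theta x)%:E)%E.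
  apply: emeasurable_funM => //; apply/measurable_EFinP.
  exact: measurable_likelihood.
have fl0 x : (0 <= f x * (likelihood s theta x)%:E)%E.
  by rewrite mule_ge0// lee_fin likelihood_ge0.
have E1 := integral_gaussian_rVS s theta mf f0.
have E2 := integral_gaussian_rVS s (0 : 'rV[R]_d.+1) mfl fl0.
apply: etrans E1 _.
apply: etrans (esym E2).
pose th : 'rV[R]_(1 + d) := theta.
pose g (xy : measurableTypeR R * 'rV[R]_d) :=
  (f (rV_cons xy) * (likelihood s (rsubmx th) xy.2)%:E)%E.
have mfc : measurable_fun setT (f \o @rV_cons R d).
  by apply: measurableT_comp => //; exact: measurable_rV_cons.
have mg : measurable_fun setT g.
  apply: emeasurable_funM => //; apply/measurable_EFinP.
  apply: measurableT_comp; [exact: measurable_likelihood|exact: measurable_snd].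
have g0 xy : (0 <= g xy)%E by rewrite mule_ge0// lee_fin likelihood_ge0.
pose P0 := gaussian_rV s (0 : 'rV[R]_d).
pose G x := (\int[P0]_y g (x, y))%E.
have mG : measurable_fun setT G by exact: measurable_fun_fubini_tonelli_F.
have G0 x : (0 <= G x)%E by exact: integral_ge0.
transitivity (\int[normal_prob (theta ord0 ord0) s]_x G x)%E.
  apply: eq_integral => x _; rewrite IH//.
  exact: (measurableT_comp mfc (measurable_pair1 x)).
apply: etrans (normal_prob_shift (theta ord0 ord0) s0 mG G0) _.
have -> : (0 : 'rV[R]_d.+1) ord0 ord0 = 0 by rewrite mxE.
have -> : rsubmx (0 : 'rV[R]_(1 + d)) = 0 by exact: linear0.
apply: eq_integral => x _.
have mgx := measurableT_comp mg (measurable_pair1 x).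
set k : \bar R := (expR _)%:E.
have k0 : (0 <= k)%E by rewrite lee_fin expR_ge0.
apply: etrans (esym (ge0_integralZr P0 measurableT mgx (fun y _ => g0 (x, y)) k0)) _.
apply: eq_integral => y _; rewrite /g -muleA -EFinM; congr (_ * _%:E)%E.
by rewrite likelihood_recl rsubmx_rV_cons rV_cons0 mulrC.
Qed.

Lemma integral_likelihood s d (theta : 'rV[R]_d) : s != 0 ->
  (\int[gaussian_rV s (0 : 'rV[R]_d)]_x (likelihood s theta x)%:E = 1)%E.
Proof.
move=> s0.
have E := @integral_gaussian_rV_likelihood s d theta (cst 1%E) s0 (measurable_cst _)
  (fun=> lee01).
rewrite [LHS]integral_cst// mul1e in E.
apply: esym; apply: etrans (esym (probability_setT (gaussian_rV s theta))) _.
by apply: etrans E _; apply: eq_integral => x _; rewrite mul1e.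
Qed.

(** The square of the norm of [theta + theta'] produces the cross term; this is why
    chi-square distances between mixtures only involve inner products. *)
Lemma likelihood_mul s d (theta theta' x : 'rV[R]_d) : s != 0 ->
  likelihood s theta x * likelihood s theta' x =
  expR (dot theta theta' / s ^+ 2) * likelihood s (theta + theta') x.
Proof.
move=> s0; rewrite /likelihood -!expRD scalerDr !dotDl !dotDr (dotC theta' theta).
by congr expR; field.
Qed.

Lemma integral_likelihood_mul s d (theta theta' : 'rV[R]_d) : s != 0 ->
  (\int[gaussian_rV s (0 : 'rV[R]_d)]_x
     (likelihood s theta x * likelihood s theta' x)%:E =
   (expR (dot theta theta' / s ^+ 2))%:E)%E.
Proof.
move=> s0; under eq_integral do rewrite likelihood_mul// EFinM.
rewrite ge0_integralZl//; first by rewrite integral_likelihood// mule1.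
- by apply/measurable_EFinP; exact: measurable_likelihood.
- by move=> x _; rewrite lee_fin likelihood_ge0.
Qed.

(** [expR (dot w x)] is, up to a constant, the likelihood ratio of the mean
    [s ^+ 2 *: w], so the integral is a mixed second moment of likelihood ratios. *)
Lemma integral_expR_dot s d (theta w : 'rV[R]_d) : s != 0 ->
  (\int[gaussian_rV s theta]_x (expR (dot w x))%:E =
   (expR (dot w theta + s ^+ 2 * dot w w / 2))%:E)%E.
Proof.
move=> s0; have mw : measurable_fun setT (fun x : 'rV[R]_d => (expR (dot w x))%:E).
  apply/measurable_EFinP; apply: measurableT_comp => //; exact: measurable_dot.
rewrite integral_gaussian_rV_likelihood//.
pose C := expR (s ^+ 2 * dot w w / 2).
transitivity (\int[gaussian_rV s (0 : 'rV[R]_d)]_x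
    (C%:E * (likelihood s theta x * likelihood s (s ^+ 2 *: w) x)%:E))%E.
  apply: eq_integral => x _; rewrite -!EFinM mulrCA mulrC; congr (_ * _)%:E.
  rewrite /C /likelihood -expRD scalerA mulVf ?sqrf_eq0// scale1r dotZl dotZr.
  by congr expR; field.
rewrite ge0_integralZl//; first last.
- exact: expR_ge0.
- by move=> x _; rewrite lee_fin mulr_ge0 ?likelihood_ge0.
- by apply/measurable_EFinP; apply: measurable_funM; exact: measurable_likelihood.
rewrite integral_likelihood_mul// -EFinM /C -expRD dotZr dotC.
by congr (expR _)%:E; field.
Qed.

Lemma integral_expR_sqr s q d (theta : 'rV[R]_d) :
  s != 0 -> 0 < 1 + 2 * q * s ^+ 2 ->
  (\int[gaussian_rV s theta]_x (expR (- (q * dot x x)))%:E =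
   ((Num.sqrt (1 + 2 * q * s ^+ 2))^-1 ^+ d *
     expR (- (q * dot theta theta / (1 + 2 * q * s ^+ 2))))%:E)%E.
Proof.
move=> s0 w0.
have mf e : measurable_fun setT (fun x : 'rV[R]_e => (expR (- (q * dot x x)))%:E).
  apply/measurable_EFinP; apply: measurableT_comp => //.
  apply: measurableT_comp => //; apply: measurable_funM => //.
  exact: measurable_dotxx.
elim: d theta => [|d IH] theta.
  by rewrite gaussian_rV0// /dot !big_ord0 expr0 !(mulr0, mul0r) oppr0 expR0 mul1r.
rewrite integral_gaussian_rVS; [|exact: mf|by move=> x; rewrite lee_fin expR_ge0].
pose th : 'rV[R]_(1 + d) := theta.
pose C := ((Num.sqrt (1 + 2 * q * s ^+ 2))^-1 ^+ d *
     expR (- (q * dot (rsubmx th) (rsubmx th) / (1 + 2 * q * s ^+ 2)))).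
have C0 : 0 <= C by rewrite mulr_ge0 ?expR_ge0// exprn_ge0// invr_ge0 sqrtr_ge0.
transitivity (\int[normal_prob (theta ord0 ord0) s]_x
    (C%:E * (expR (- (q * x ^+ 2)))%:E))%E.
  apply: eq_integral => x _; rewrite muleC -IH -ge0_integralZl//; last exact: mf.
  apply: eq_integral => y _; rewrite -EFinM -expRD; congr (expR _)%:E.
  by rewrite (@dot_recl _ d) rsubmx_rV_cons rV_cons0/=; ring.
rewrite ge0_integralZl//; last first.
- apply/measurable_EFinP; apply: measurableT_comp => //.
  by apply: measurableT_comp => //; apply: measurable_funM.
rewrite integral_normal_prob_expR_sqr// -EFinM /C mulrACA -exprSr -expRD.
congr (_ * expR _)%:E; rewrite (@dot_recl _ d).
by field; rewrite gt_eqF.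
Qed.

End likelihood_ratios.

(** * The linear test *)

Section linear_testing.
Context {R : realType}.
Implicit Types (alpha beta b : R) (n : nat).

Lemma measure_le_integral dsp (T : measurableType dsp)
    (mu : {measure set T -> \bar R}) (A : set T) (g : T -> R) :
  measurable A -> measurable_fun setT g -> (forall x, 0 <= g x) ->
  (forall x, A x -> 1 <= g x) -> (mu A <= \int[mu]_x (g x)%:E)%E.
Proof.
move=> mA mg g0 g1; rewrite -[A]setIT -integral_indic//.
apply: ge0_le_integral => //.
- by apply/measurable_EFinP; exact: measurable_indic.
- by apply/measurable_EFinP.
move=> x _; rewrite lee_fin indicE; case: (boolP (x \in A)) => [|_] //.
by rewrite inE => /g1.
Qed.

Lemma law_sd_neq0 n : (0 < n)%N -> (Num.sqrt n%:R)^-1 != 0 :> R.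
Proof. by move=> n0; rewrite invr_eq0 gt_eqF// sqrtr_gt0 ltr0n. Qed.

Lemma law_sd_sqr n : (Num.sqrt n%:R)^-1 ^+ 2 = n%:R^-1 :> R.
Proof. by rewrite exprVn sqr_sqrtr. Qed.

(** Chernoff bound with the exponent [dot w x]. *)
Lemma law_dot_tail n d (theta w : 'rV[R]_d) (a : R) (A : set 'rV[R]_d) :
  (0 < n)%N -> measurable A -> (forall x, A x -> a <= dot w x) ->
  (law n theta A <=
    (expR (dot w theta + n%:R^-1 * dot w w / 2 - a))%:E)%E.
Proof.
move=> n0 mA Aa; pose g x := expR (- a) * expR (dot w x).
apply: le_trans (_ : _ <= \int[law n theta]_x (g x)%:E)%E _.
  apply: measure_le_integral => //.
  - apply: measurable_funM => //; apply: measurableT_comp => //.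
    exact: measurable_dot.
  - by move=> x; rewrite mulr_ge0 ?expR_ge0.
  - by move=> x /Aa; rewrite /g -expRD -expR0 ler_expR; lra.
under eq_integral do rewrite EFinM.
rewrite ge0_integralZl//; last first.
  apply/measurable_EFinP; apply: measurableT_comp => //.
  exact: measurable_dot.
rewrite integral_expR_dot ?law_sd_neq0// law_sd_sqr -EFinM -expRD lee_fin.
by rewrite ler_expR; lra.
Qed.

Lemma ex_test d (f : 'rV[R]_d -> R) (t : R) : measurable_fun setT f ->
  exists psi : {mfun 'rV[R]_d >-> bool}, forall x, psi x = (t < f x).
Proof.
move=> mf; have mpsi : measurable_fun setT (fun x => t < f x).
  exact: measurable_fun_ltr.
pose h : {mfun 'rV[R]_d >-> bool} :=
  HB.pack (fun x => t < f x) (isMeasurableFun.Build _ _ _ _ _ mpsi).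
by exists h.
Qed.

Lemma measurable_test d (psi : {mfun 'rV[R]_d >-> bool}) (c : bool) :
  measurable [set x | psi x = c].
Proof.
rewrite (_ : mkset _ = psi @^-1` [set c])//.
by rewrite -[X in measurable X]setTI; exact: measurable_funP.
Qed.

(** Under the null law the statistic [sqrt n * dot u x] is standard normal, and
    [theta] shifts it by [sqrt n * dot u theta].  The test is two-sided since in
    dimension one an alternative may have points on both sides of the origin. *)
Lemma linear_test alpha b n d (u : 'rV[R]_d) :
  0 < alpha -> 0 < b -> (0 < n)%N -> dot u u = 1 ->
  exists psi : {mfun 'rV[R]_d >-> bool}, valid alpha n psi /\
    forall theta, 1 - ln (alpha / 2) - ln b <= Num.sqrt n%:R * `|dot u theta| ->
      (law n theta [set x | psi x = false] <= b%:E)%E.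
Proof.
move=> a0 b0 n0 u1; pose r : R := Num.sqrt n%:R.
have r0 : 0 <= r by exact: sqrtr_ge0.
have nr : n%:R^-1 * r ^+ 2 = 1.
  by rewrite sqr_sqrtr// mulVf// pnatr_eq0 -lt0n.
pose t := 2^-1 - ln (alpha / 2).
have [psi psiE] : exists psi : {mfun 'rV[R]_d >-> bool},
    forall x, psi x = (t < r * `|dot u x|).
  apply: ex_test; apply: measurable_funM => //; apply: measurableT_comp => //.
  exact: measurable_dot.
have tail (e : R) theta c A : e ^+ 2 = 1 -> measurable A ->
    (forall x, A x -> c <= r * (e * dot u x)) ->
    (law n theta A <= (expR (r * (e * dot u theta) + 2^-1 - c))%:E)%E.
  move=> e1 mA Ac.
  apply: le_trans (@law_dot_tail _ _ _ ((r * e) *: u) c _ _ _ _) _ => //.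
    by move=> x /Ac; rewrite dotZl mulrA.
  rewrite lee_fin ler_expR !dotZl dotZr u1.
  have -> : n%:R^-1 * (r * e * (r * e * 1)) / 2 =
      (n%:R^-1 * r ^+ 2) * e ^+ 2 / 2 by ring.
  by rewrite nr e1; lra.
have mhalf (e : R) : measurable [set x : 'rV[R]_d | t < r * (e * dot u x)].
  have [h hE] : exists h : {mfun 'rV[R]_d >-> bool},
      forall x, h x = (t < r * (e * dot u x)).
    apply: ex_test; apply: measurable_funM => //; apply: measurable_funM => //.
    exact: measurable_dot.
  rewrite (_ : mkset _ = [set x | h x = true]); first exact: measurable_test.
  by apply/seteqP; split => x /=; rewrite hE.
exists psi; split.
  rewrite /valid; set A := mkset _.
  pose B (e : R) := [set x : 'rV[R]_d | t < r * (e * dot u x)].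
  have AB : A `<=` B 1 `|` B (-1).
    move=> x; rewrite /A /B /= psiE mul1r mulN1r.
    by case: (ger0P (dot u x)) => _; [left|right].
  apply: le_trans (le_measure _ _ _ AB) _; rewrite ?inE.
  - exact: measurable_test.
  - by apply: measurableU; exact: mhalf.
  apply: le_trans (measureU2 _ (mhalf 1) (mhalf (-1))) _.
  have Be (e : R) : e ^+ 2 = 1 -> (law n (0 : 'rV[R]_d) (B e) <= (alpha / 2)%:E)%E.
    move=> e1; apply: le_trans (tail e 0 t _ e1 _ _) _; first exact: mhalf.
      by move=> x /ltW.
    rewrite lee_fin -[leRHS](lnK (x := alpha / 2)) ?posrE ?divr_gt0// ler_expR.
    by rewrite dot0r /t; lra.
  apply: le_trans (leeD (Be 1 _) (Be (-1) _)) _; rewrite ?expr1n ?sqrrN ?expr1n//.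
  by rewrite -EFinD lee_fin; lra.
move=> theta; rewrite -/r => big.
(* Chernoff's exponent points away from [theta]: accepting means that the component
   on the side of [theta] is small. *)
pose e : R := if 0 <= dot u theta then -1 else 1.
have e1 : e ^+ 2 = 1 by rewrite /e; case: ifP; rewrite ?sqrrN expr1n.
have eN : e * dot u theta = - `|dot u theta|.
  by rewrite /e; case: (ger0P (dot u theta)) => _; ring.
apply: le_trans (tail e theta (- t) _ e1 (measurable_test _ _) _) _.
  move=> x /= /negbT; rewrite psiE -leNgt => le_t; rewrite lerNl -mulrN.
  apply: le_trans le_t; apply: ler_wpM2l => //.
  rewrite /e; case: ifP => _; first by rewrite mulN1r opprK ler_norm.
  by rewrite mul1r -normrN ler_norm.
rewrite lee_fin -[leRHS](lnK (x := b)) ?posrE// ler_expR eN /t; lra.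
Qed.

End linear_testing.

(** * The quadratic test *)

Section quadratic_testing.
Context {R : realType}.
Implicit Types (alpha beta b : R) (n : nat).
Local Opaque gaussian_rV.

(** Second order bound for [- ln (1 + v) / 2], that is, for the logarithm of the
    factor that each coordinate contributes to the moment of a squared norm. *)
Lemma invr_sqrt_le (v : R) : - 2^-1 <= v ->
  (Num.sqrt (1 + v))^-1 <= expR ((- v + 2 * v ^+ 2) / 2).
Proof.
move=> v0; set y := - v + 2 * v ^+ 2; have w0 : 0 < 1 + v by lra.
rewrite -[leRHS]ger0_norm ?expR_ge0// -sqrtr_sqr expr2 -expRD.
have -> : y / 2 + y / 2 = y by field.
rewrite -(sqrtrV (ltW w0)); apply: ler_wsqrtr.
rewrite -[(1 + v)^-1]mul1r ler_pdivrMr//.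
have := expR_ge1Dx y; rewrite -(ler_pM2r w0); apply: le_trans.
have -> : (1 + y) * (1 + v) = 1 + v ^+ 2 * (1 + 2 * v) by rewrite /y; ring.
by rewrite lerDl mulr_ge0 ?sqr_ge0//; lra.
Qed.

(** Chernoff bound for the squared norm: positive [v] controls the lower tail and
    negative [v] the upper tail. *)
Lemma law_sqr_tail n d (theta : 'rV[R]_d) (v c : R) (A : set 'rV[R]_d) :
  (0 < n)%N -> - 2^-1 <= v -> measurable A ->
  (forall x, A x -> c <= - (v / 2 * (n%:R * dot x x))) ->
  (law n theta A <= (expR (d%:R * ((- v + 2 * v ^+ 2) / 2)
     - v / 2 * (n%:R * dot theta theta) / (1 + v) - c))%:E)%E.
Proof.
move=> n0 v0 mA Ac; have nn0 : n%:R != 0 :> R by rewrite pnatr_eq0 -lt0n.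
have w0 : 0 < 1 + v by lra.
pose q := v / 2 * n%:R; pose g (x : 'rV[R]_d) := expR (- c) * expR (- (q * dot x x)).
have mexp : measurable_fun setT (fun x : 'rV[R]_d => expR (- (q * dot x x))).
  apply: measurableT_comp => //; apply: measurableT_comp => //.
  by apply: measurable_funM => //; exact: measurable_dotxx.
apply: le_trans (_ : _ <= \int[law n theta]_x (g x)%:E)%E _.
  apply: measure_le_integral => //.
  - by apply: measurable_funM.
  - by move=> x; rewrite mulr_ge0 ?expR_ge0.
  - by move=> x /Ac; rewrite mulrA -/q /g -expRD -expR0 ler_expR; lra.
under eq_integral do rewrite EFinM.
rewrite ge0_integralZl//; last by apply/measurable_EFinP.
have sE : 1 + 2 * q * (Num.sqrt n%:R)^-1 ^+ 2 = 1 + v :> R.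
  by rewrite law_sd_sqr /q; field.
rewrite integral_expR_sqr ?law_sd_neq0 ?sE// -EFinM lee_fin.
rewrite (mulrA (v / 2)) -/q !expRD [leRHS]mulrC.
rewrite ler_wpM2l ?expR_ge0// ler_wpM2r ?expR_ge0//.
rewrite expRM_natl lerXn2r ?nnegrE ?expR_ge0 ?invr_ge0 ?sqrtr_ge0//.
exact: invr_sqrt_le.
Qed.

(** The statistic [n * dot x x] has mean [d + n * dot theta theta], and its standard
    deviation under the null law is of order [sqrt d]. *)
Lemma quadratic_test alpha b n d : 0 < alpha -> 0 < b -> (0 < n)%N -> (0 < d)%N ->
  exists psi : {mfun 'rV[R]_d >-> bool}, valid alpha n psi /\
    forall theta : 'rV[R]_d,
      (3 - 6 * ln alpha - 6 * ln b) * Num.sqrt d%:R <= n%:R * dot theta theta ->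
      (law n theta [set x | psi x = false] <= b%:E)%E.
Proof.
move=> a0 b0 n0 d0; pose r : R := Num.sqrt d%:R.
have r1 : 1 <= r by rewrite -sqrtr1; apply: ler_wsqrtr; rewrite ler1n.
have r0 : r != 0 by rewrite gt_eqF// (lt_le_trans ltr01).
have dE : d%:R = r ^+ 2 by rewrite sqr_sqrtr.
(* With this [s] and [v = 2 * s], the second order terms of the [d] coordinates add
   up to [d * v ^+ 2 = 4^-1], independently of [d]. *)
pose t := 1 - 4 * ln alpha; pose s := (4 * r)^-1.
have s0 : 0 < s by rewrite invr_gt0 mulr_gt0// (lt_le_trans ltr01).
have s4 : s <= 4^-1 by rewrite lef_pV2 ?posrE ?mulr_gt0 ?(lt_le_trans ltr01)//; lra.
have sr : s * r = 4^-1 by rewrite /s; field.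
have [psi psiE] : exists psi : {mfun 'rV[R]_d >-> bool},
    forall x, psi x = (r ^+ 2 + t * r < n%:R * dot x x).
  by apply: ex_test; apply: measurable_funM => //; exact: measurable_dotxx.
exists psi; split.
  apply: le_trans (@law_sqr_tail n d 0 (- (2 * s)) (s * (r ^+ 2 + t * r)) _ n0 _
    (measurable_test _ _) _) _.
  - lra.
  - move=> x /=; rewrite psiE => /ltW le_x.
    have -> : - (- (2 * s) / 2 * (n%:R * dot x x)) = s * (n%:R * dot x x) by field.
    by apply: ler_wpM2l => //; exact: ltW.
  rewrite dot0r lee_fin -[leRHS](lnK (x := alpha)) ?posrE// ler_expR dE.
  have -> : r ^+ 2 * ((- - (2 * s) + 2 * (- (2 * s)) ^+ 2) / 2) -
      - (2 * s) / 2 * (n%:R * 0) / (1 + - (2 * s)) - s * (r ^+ 2 + t * r) =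
      4 * (s * r) ^+ 2 - t * (s * r) by rewrite !(mulr0, mul0r); field.
  by rewrite sr /t; lra.
move=> theta big; set lam := n%:R * dot theta theta in big.
apply: le_trans (@law_sqr_tail n d theta (2 * s) (- (s * (r ^+ 2 + t * r))) _ n0 _
    (measurable_test _ _) _) _.
- lra.
- move=> x /= /negbT; rewrite psiE -leNgt => le_x.
  have -> : 2 * s / 2 * (n%:R * dot x x) = s * (n%:R * dot x x) by field.
  by rewrite lerN2; apply: ler_wpM2l => //; exact: ltW.
rewrite lee_fin -[leRHS](lnK (x := b)) ?posrE// ler_expR dE -/lam.
have lam0 : 0 <= s * lam by rewrite mulr_ge0 ?(ltW s0)// mulr_ge0 ?dot_ge0.
have frac : s * lam * (2 / 3) <= s * lam / (1 + 2 * s).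
  by rewrite ler_wpM2l// -[2 / 3]invrK lef_pV2 ?posrE; lra.
have big' : 4^-1 * (3 - 6 * ln alpha - 6 * ln b) <= s * lam.
  by rewrite -sr -mulrA; apply: ler_wpM2l; [exact: ltW|rewrite mulrC].
have -> : r ^+ 2 * ((- (2 * s) + 2 * (2 * s) ^+ 2) / 2) -
      2 * s / 2 * lam / (1 + 2 * s) - - (s * (r ^+ 2 + t * r)) =
      4 * (s * r) ^+ 2 + t * (s * r) - s * lam / (1 + 2 * s).
  by field; lra.
by rewrite sr /t; lra.
Qed.

End quadratic_testing.

(** * Indistinguishable mixtures *)

Section lower.
Context {R : realType}.
Implicit Types (alpha beta b : R) (n : nat).
Local Opaque gaussian_rV.

Lemma gaussian_rV_likelihood s d (theta : 'rV[R]_d) (A : set 'rV[R]_d) :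
  s != 0 -> measurable A ->
  (\int[gaussian_rV s (0 : 'rV[R]_d)]_x (\1_A x * likelihood s theta x)%:E =
   gaussian_rV s theta A)%E.
Proof.
move=> s0 mA; rewrite -[A in RHS]setIT -integral_indic//.
apply: esym; apply: etrans (integral_gaussian_rV_likelihood _ s0 _ _) _.
- by apply/measurable_EFinP; exact: measurable_indic.
- by move=> x; rewrite lee_fin.
- by apply: eq_integral => x _; rewrite EFinM.
Qed.

(** Bounding total variation by the chi-square distance.  With [L] the likelihood
    ratio of the uniform mixture, the inequality
    [2 * delta * \1_A * (L - 1) <= delta ^+ 2 + (L - 1) ^+ 2] is integrated under the
    null law, after all terms have been moved to the side where they are
    nonnegative, so that no integrability has to be checked. *)
Lemma sum_law_le_chi2 (I : finType) n d (theta : I -> 'rV[R]_d) (A : set 'rV[R]_d)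
    (delta : R) :
  (0 < n)%N -> 0 < delta -> measurable A -> (0 < #|I|)%N ->
  \sum_i \sum_j expR (n%:R * dot (theta i) (theta j)) <=
    (1 + delta ^+ 2) * #|I|%:R ^+ 2 ->
  \sum_i fine (law n (theta i) A) <=
    #|I|%:R * (fine (law n (0 : 'rV[R]_d) A) + delta).
Proof.
move=> n0 dl0 mA I0 chi; set N : R := #|I|%:R in chi *.
have N0 : 0 < N by rewrite ltr0n.
pose s : R := (Num.sqrt n%:R)^-1; have s0 : s != 0 := law_sd_neq0 n0.
pose P0 := gaussian_rV s (0 : 'rV[R]_d).
pose l i x := likelihood s (theta i) x.
have ml i : measurable_fun setT (l i) by exact: measurable_likelihood.
have l0 i x : 0 <= l i x by exact: likelihood_ge0.
pose S x := \sum_i l i x.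
have mS : measurable_fun setT S by exact: measurable_sum.
have S0 x : 0 <= S x by exact: sumr_ge0.
have m1 : measurable_fun setT (\1_A : 'rV[R]_d -> R) by exact: measurable_indic.
have ESum (f : I -> 'rV[R]_d -> R) : (forall i, measurable_fun setT (f i)) ->
    (forall i x, 0 <= f i x) ->
    (\int[P0]_x (\sum_i f i x)%:E = \sum_i \int[P0]_x (f i x)%:E)%E.
  move=> mf f0; under eq_integral do rewrite -sumEFin.
  rewrite ge0_integral_sum// => [i|i x _]; first exact/measurable_EFinP.
  by rewrite lee_fin.
have EA : (\int[P0]_x (\1_A x * S x)%:E = (\sum_i fine (law n (theta i) A))%:E)%E.
  under eq_integral do rewrite mulr_sumr.
  rewrite ESum; first last.
  - by move=> i x; rewrite mulr_ge0.
  - by move=> i; exact: measurable_funM.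
  rewrite -sumEFin; apply: eq_bigr => i _.
  rewrite gaussian_rV_likelihood// fineK// fin_num_measure//.
have ES : (\int[P0]_x (S x)%:E = N%:E)%E.
  rewrite ESum// (eq_bigr (fun=> 1%:E)) => [|i _]; last exact: integral_likelihood.
  by rewrite sumEFin sumr_const.
have ES2 : (\int[P0]_x (S x ^+ 2)%:E =
    (\sum_i \sum_j expR (n%:R * dot (theta i) (theta j)))%:E)%E.
  transitivity (\int[P0]_x (\sum_i \sum_j l i x * l j x)%:E)%E.
    apply: eq_integral => x _; congr _%:E.
    by rewrite expr2 /S mulr_suml; apply: eq_bigr => i _; rewrite mulr_sumr.
  have lM0 i j x : 0 <= l i x * l j x by rewrite mulr_ge0.
  have mlM i j : measurable_fun setT (fun x => l i x * l j x).
    exact: measurable_funM.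
  rewrite ESum; first last.
  - by move=> i x; exact: sumr_ge0.
  - by move=> i; exact: measurable_sum.
  rewrite -sumEFin; apply: eq_bigr => i _; rewrite ESum// -sumEFin.
  apply: eq_bigr => j _; rewrite integral_likelihood_mul// /s law_sd_sqr invrK.
  by rewrite mulrC.
have E1 : (\int[P0]_x (\1_A x)%:E = (fine (law n (0 : 'rV[R]_d) A))%:E)%E.
  by rewrite integral_indic// setIT fineK// fin_num_measure.
have EZ : forall k (f : 'rV[R]_d -> R) e, 0 <= k -> measurable_fun setT f ->
    (forall x, 0 <= f x) -> (\int[P0]_x (f x)%:E = e%:E)%E ->
    (\int[P0]_x (k * f x)%:E = (k * e)%:E)%E.
  move=> k f e k0 mf f0 fe; under eq_integral do rewrite EFinM.
  rewrite ge0_integralZl//; first by rewrite fe.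
    exact/measurable_EFinP.
  by move=> x _; rewrite lee_fin.
have ED : forall (h g : 'rV[R]_d -> R) a a', measurable_fun setT h ->
    (forall x, 0 <= h x) -> measurable_fun setT g -> (forall x, 0 <= g x) ->
    (\int[P0]_x (h x)%:E = a%:E)%E -> (\int[P0]_x (g x)%:E = a'%:E)%E ->
    (\int[P0]_x (h x + g x)%:E = (a + a')%:E)%E.
  move=> h g a a' mh h0 mg g0 ha ga; under eq_integral do rewrite EFinD.
  rewrite ge0_integralD//; first by rewrite ha ga.
  - by move=> x _; rewrite lee_fin.
  - exact/measurable_EFinP.
  - by move=> x _; rewrite lee_fin.
  - exact/measurable_EFinP.
have d2 : 0 <= 2 * delta * N by rewrite !mulr_ge0// ltW.
have N2 : 0 <= 2 * N by rewrite mulr_ge0// ltW.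
have d3 : 0 <= 2 * delta * N ^+ 2 by rewrite !mulr_ge0// ?sqr_ge0// ltW.
pose K := delta ^+ 2 * N ^+ 2 + N ^+ 2.
have K0 : 0 <= K by rewrite /K -exprMn addr_ge0 ?sqr_ge0.
have EK : (\int[P0]_x K%:E = K%:E)%E.
  by rewrite integral_cst// [X in (_ * X)%E](probability_setT P0) mule1.
have ind0 x : 0 <= \1_A x :> R by [].
have mAS : measurable_fun setT (fun x => \1_A x * S x) by exact: measurable_funM.
have AS0 x : 0 <= \1_A x * S x by exact: mulr_ge0.
have mS2 : measurable_fun setT (fun x => S x ^+ 2) by exact: measurable_funX.
have S20 x : 0 <= S x ^+ 2 by exact: sqr_ge0.
(* With [L = S x / N], this is [2 * N ^+ 2 * delta] times the bound on
   [\1_A * (L - 1)] by [delta / 2 + (L - 1) ^+ 2 / (2 * delta)]. *)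
have key x : 2 * delta * N * (\1_A x * S x) + 2 * N * S x <=
    2 * delta * N ^+ 2 * \1_A x + (K + S x ^+ 2).
  rewrite indicE; case: (x \in A) => /=.
    have := sqr_ge0 (delta * N - (S x - N)); rewrite /K; nra.
  have := sqr_ge0 (S x - N); have := sqr_ge0 (delta * N); rewrite /K; nra.
have mL : measurable_fun setT
    (fun x => 2 * delta * N * (\1_A x * S x) + 2 * N * S x).
  by apply: measurable_funD; apply: measurable_funM => //; exact: measurable_funM.
have mR : measurable_fun setT
    (fun x => 2 * delta * N ^+ 2 * \1_A x + (K + S x ^+ 2)).
  apply: measurable_funD; first exact: measurable_funM.
  by apply: measurable_funD => //; exact: measurable_funX.
have : (\int[P0]_x (2 * delta * N * (\1_A x * S x) + 2 * N * S x)%:E <=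
    \int[P0]_x (2 * delta * N ^+ 2 * \1_A x + (K + S x ^+ 2))%:E)%E.
  apply: ge0_le_integral => //.
  - by move=> x _; rewrite lee_fin; apply: addr_ge0; exact: mulr_ge0.
  - exact/measurable_EFinP.
  - exact/measurable_EFinP.
  - by move=> x _; rewrite lee_fin.
have ER := ED (cst K) _ _ _ (measurable_cst _) (fun=> K0) mS2 S20 EK ES2.
have EAS := EZ _ _ _ d2 mAS AS0 EA; have ESN := EZ _ _ _ N2 mS S0 ES.
have EAN := EZ _ _ _ d3 m1 ind0 E1.
rewrite (ED _ _ _ _ _ _ _ _ EAS ESN) ?(ED _ _ _ _ _ _ _ _ EAN ER).
all: try exact: measurable_funM.
all: try by move=> x; first [exact: addr_ge0 | exact: mulr_ge0].
all: try exact: measurable_funD.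
rewrite lee_fin => le.
have c0 : 0 < 2 * delta * N by rewrite !mulr_gt0.
rewrite -(ler_pM2l c0); move: le chi; rewrite /K; lra.
Qed.

Lemma powerful_law_ge n d (that theta : 'rV[R]_d) beta eps r
    (psi : {mfun 'rV[R]_d >-> bool}) :
  powerful beta n that eps r psi -> H1 that eps r theta ->
  1 - beta < fine (law n theta [set x | psi x = true]).
Proof.
move=> pow Ht; have mT := measurable_test psi true.
have : (law n theta [set x | psi x = false] < beta%:E)%E.
  by apply: le_lt_trans pow; apply: ereal_sup_ubound; exists theta.
have -> : [set x | psi x = false] = ~` [set x | psi x = true].
  by apply/seteqP; split => x /=; case: (psi x).
rewrite probability_setC//.
have fin : law n theta [set x | psi x = true] \is a fin_num.
  exact: fin_num_measure.
by rewrite -[X in (1 - X)%E]fineK// -EFinB lte_fin; lra.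
Qed.

(** A powerful test rejects with probability more than [1 - beta] under each
    [theta i], hence under their mixture, while a valid one rejects with probability
    at most [alpha] under the null law: the total variation distance would exceed
    [1 - alpha - beta]. *)
Lemma not_powerful (I : finType) n d (theta : I -> 'rV[R]_d) (that : 'rV[R]_d)
    alpha beta eps r :
  (0 < n)%N -> (0 < #|I|)%N -> beta < 1 - alpha ->
  (forall i, H1 that eps r (theta i)) ->
  \sum_i \sum_j expR (n%:R * dot (theta i) (theta j)) <=
    (1 + (1 - alpha - beta) ^+ 2) * #|I|%:R ^+ 2 ->
  forall psi : {mfun 'rV[R]_d >-> bool},
    valid alpha n psi -> ~ powerful beta n that eps r psi.
Proof.
move=> n0 I0 ab thetaH1 chi psi val pow.
have mT := measurable_test psi true.
have dl0 : 0 < 1 - alpha - beta by lra.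
have N0 : 0 < #|I|%:R :> R by rewrite ltr0n.
have := sum_law_le_chi2 n0 dl0 mT I0 chi.
have p0 : fine (law n (0 : 'rV[R]_d) [set x | psi x = true]) <= alpha.
  by rewrite -lee_fin fineK// fin_num_measure.
suff lb : #|I|%:R * (1 - beta) <
    \sum_i fine (law n (theta i) [set x | psi x = true]).
  move=> /(lt_le_trans lb); rewrite ltr_pM2l//; lra.
have [i0 _|] := pickP I; last by move=> I0'; move: I0; rewrite (eq_card0 I0').
have -> : #|I|%:R * (1 - beta) = \sum_(i : I) (1 - beta).
  by rewrite sumr_const mulr_natl.
apply: ltr_sum => [|i _].
  by apply/hasP; exists i0; rewrite ?mem_index_enum.
exact: powerful_law_ge (thetaH1 i).
Qed.

End lower.

(** * Geometry of the alternative *)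

Section geometry.
Context {R : realType}.

Section prediction.
Variables (d : nat) (that : 'rV[R]_d).
Hypothesis that0 : that != 0.
Implicit Types (theta : 'rV[R]_d) (eps r : R).

Definition direction : 'rV[R]_d := (norm2 that)^-1 *: that.

Let N0 : 0 < norm2 that. Proof. by rewrite norm2_gt0. Qed.

Lemma direction_unit : dot direction direction = 1.
Proof. by rewrite dotZl dotZr -norm2_sqr; field; rewrite gt_eqF. Qed.

Lemma norm2_direction : norm2 direction = 1.
Proof. by rewrite /norm2 direction_unit sqrtr1. Qed.

Lemma dot_that theta : dot theta that = norm2 that * dot direction theta.
Proof. by rewrite dotZl mulVKf ?gt_eqF// dotC. Qed.

Lemma dot_direction_that : dot direction that = norm2 that.
Proof. by rewrite dotZl -norm2_sqr expr2 mulKf// gt_eqF. Qed.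

Lemma proj_lineE theta : proj_line that theta = dot direction theta *: direction.
Proof.
rewrite /proj_line dot_that -norm2_sqr scalerA; congr (_ *: _).
by field; rewrite gt_eqF.
Qed.

Lemma norm2_proj_line theta : norm2 (proj_line that theta) = `|dot direction theta|.
Proof. by rewrite proj_lineE norm2Z norm2_direction mulr1. Qed.

Lemma cos_sim_proj_line theta :
  cos_sim (proj_line that theta) theta = `|dot direction theta| / norm2 theta.
Proof.
rewrite /cos_sim; case: ifPn => [/andP[p0 t0]|]; last first.
  rewrite -norm2_gt0 norm2_proj_line negb_and -norm2_gt0 => /orP[].
    rewrite -leNgt => p0; suff -> : `|dot direction theta| = 0 by rewrite mul0r.
    by apply/le_anti; rewrite p0 normr_ge0.
  rewrite -leNgt => t0; suff -> : norm2 theta = 0 by rewrite invr0 mulr0.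
  by apply/le_anti; rewrite t0 norm2_ge0.
rewrite norm2_proj_line; move: p0 t0; rewrite -!norm2_gt0 norm2_proj_line => p0 t0.
rewrite proj_lineE dotZl -expr2 -(real_normK (num_real (dot direction theta))).
by field; rewrite !gt_eqF.
Qed.

Lemma normr_dot_direction_le theta : `|dot direction theta| <= norm2 theta.
Proof.
have H t : dot direction t <= norm2 t.
  by have := dot_Cauchy_Schwarz direction t; rewrite norm2_direction mul1r.
by rewrite ler_norml lerNl -dotNr -(norm2N theta) H norm2N H.
Qed.

(** The component along the prediction of a point where the sphere of radius [eps]
    meets the boundary of the prediction ball. *)
Definition height eps r : R :=
  (norm2 that ^+ 2 + eps ^+ 2 - r ^+ 2) / (2 * norm2 that).

Lemma pred_ballE theta r : 0 <= r ->
  (norm2 (theta - that) <= r) =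
  (dot theta theta + norm2 that ^+ 2 - r ^+ 2 <=
    2 * norm2 that * dot direction theta).
Proof.
move=> r0; rewrite -[LHS]ler_sqr ?nnegrE ?norm2_ge0// (norm2_sqr (theta - that)).
rewrite !dotBl !dotBr (dotC that theta) dot_that -(norm2_sqr that).
by apply/idP/idP; lra.
Qed.

Lemma H1_height theta eps r : 0 <= eps -> 0 <= r -> H1 that eps r theta ->
  height eps r <= dot direction theta.
Proof.
move=> e0 r0 [et]; rewrite pred_ballE// => tr.
rewrite /height ler_pdivrMr ?mulr_gt0//.
have : eps ^+ 2 <= dot theta theta by rewrite -norm2_sqr ler_sqr ?nnegrE ?norm2_ge0.
lra.
Qed.

Lemma capP theta eps r : 0 <= r -> norm2 theta = eps ->
  height eps r <= dot direction theta -> cap that eps r theta.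
Proof.
move=> r0 te; rewrite /height ler_pdivrMr ?mulr_gt0// => h; split => //=.
by rewrite /pred_ball /= pred_ballE// -norm2_sqr te; lra.
Qed.

Lemma cap_H1 theta eps r : cap that eps r theta -> H1 that eps r theta.
Proof. by move=> [/= <- tr]; split. Qed.

Lemma cap_nonempty eps r : 0 <= eps -> 0 <= r ->
  cap that eps r !=set0 <-> height eps r <= eps.
Proof.
move=> e0 r0; split => [[theta ct]|he].
  apply: le_trans (H1_height e0 r0 (cap_H1 ct)) _.
  by case: ct => /= <- _; apply: le_trans (ler_norm _) (normr_dot_direction_le _).
exists (eps *: direction); apply: capP => //; last first.
  by rewrite dotZr direction_unit mulr1.
by rewrite norm2Z norm2_direction mulr1 ger0_norm.
Qed.

Lemma height_le eps r : 0 <= r ->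
  (height eps r <= eps) = (`|norm2 that - eps| <= r).
Proof.
move=> r0; rewrite -[RHS]ler_sqr ?nnegrE ?normr_ge0// real_normK ?num_real//.
by rewrite /height ler_pdivrMr ?mulr_gt0//; apply/idP/idP; lra.
Qed.

Lemma admissible_le eps r : admissible that eps r -> eps <= norm2 that + r.
Proof.
move=> [_ e0 r0 nsub]; rewrite leNgt; apply/negP => lt; apply: nsub => theta /= tr.
rewrite /oball2 /=; apply: le_lt_trans lt.
rewrite -[theta](subrKC that); apply: le_trans (norm2_triangle _ _) _.
by rewrite lerD2l.
Qed.

Lemma ball_direction theta r : norm2 (theta - that) <= r ->
  norm2 that - r <= dot direction theta.
Proof.
move=> tr; have := le_trans (ler_norm _) (normr_dot_direction_le (that - theta)).
rewrite -norm2N opprB dotBr dot_direction_that; lra.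
Qed.

(** The minimum is attained at [(norm2 that - r) *: direction that]. *)
Lemma norm2_theta_star r : 0 <= r -> r < norm2 that ->
  norm2 (theta_star that r) = norm2 that - r.
Proof.
move=> r0 rN; pose p := (norm2 that - r) *: direction.
have pN : norm2 p = norm2 that - r.
  by rewrite norm2Z norm2_direction mulr1 ger0_norm// subr_ge0 ltW.
have bp : pred_ball that r p.
  rewrite /pred_ball /= pred_ballE// -norm2_sqr pN dotZr direction_unit; nra.
have lb theta : pred_ball that r theta -> norm2 that - r <= norm2 theta.
  move=> /ball_direction le; apply: le_trans le _.
  exact: le_trans (ler_norm _) (normr_dot_direction_le _).
have [] : [set theta | pred_ball that r theta /\
    forall theta', pred_ball that r theta' ->
      norm2 theta ^+ 2 <= norm2 theta' ^+ 2] (theta_star that r).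
  apply: (@getPex _ [set theta | pred_ball that r theta /\
    forall theta', pred_ball that r theta' ->
      norm2 theta ^+ 2 <= norm2 theta' ^+ 2]).
  exists p; split => // theta /lb le.
  by rewrite pN ler_sqr ?nnegrE ?norm2_ge0// subr_ge0 ltW.
move=> bs /(_ p bp); rewrite ler_sqr ?nnegrE ?norm2_ge0// pN => le.
by apply/le_anti; rewrite le lb.
Qed.

(** The value of [gamma_star] when the cap is nonempty.  In dimension one the sphere
    is a pair of points, both with component [eps] in absolute value. *)
Definition gap eps r : R := if d == 1%N then eps else Num.max 0 (height eps r).

(** Within the ball, the lower bound on the component along the prediction grows with
    the norm, so the bound valid on the sphere extends to the whole alternative.  In
    dimension one the component is the norm, up to the sign. *)
Lemma gap_le theta eps r : 0 <= eps -> 0 <= r -> H1 that eps r theta ->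
  gap eps r <= `|dot direction theta|.
Proof.
move=> e0 r0 Ht; rewrite /gap; case: eqP => [d1|_]; last first.
  rewrite ge_max normr_ge0/=; apply: le_trans (H1_height e0 r0 Ht) (ler_norm _).
case: Ht => /le_trans et _; apply: et.
suff E : dot direction theta ^+ 2 = dot direction direction * dot theta theta.
  by rewrite /norm2 -[dot theta theta]mul1r -direction_unit -E sqrtr_sqr.
(* Inner products are products of coordinates: Cauchy-Schwarz is an equality. *)
have F (u v : 'rV[R]_d) : exists a b : R,
    [/\ dot u v = a * b, dot u u = a * a & dot v v = b * b].
  clear -d1; move: u v; rewrite d1 => u v; exists (u 0 0), (v 0 0).
  by rewrite /dot !big_ord_recl !big_ord0 !addr0.
by have [a [b [-> -> ->]]] := F direction theta; ring.
Qed.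

End prediction.

(** The sphere and the ball can only be disjoint in two ways, and admissibility
    rules out that the ball is inside the sphere. *)
Lemma separatedE d (that : 'rV[R]_d) (eps r : R) : admissible that eps r ->
  cap that eps r = set0 <-> eps < norm2 that - r.
Proof.
move=> adm; have eNr := admissible_le adm; have [that0 e0 r0 _] := adm.
split=> [c0|lt].
  rewrite ltNge; apply/negP => le; have : cap that eps r !=set0; last first.
    by rewrite c0 => -[].
  apply/cap_nonempty => //; first exact: ltW.
  by rewrite height_le// ler_norml; apply/andP; split; lra.
apply/eqP/negP => /negP/set0P/cap_nonempty.
rewrite height_le// => /(_ that0 (ltW e0) r0).
by rewrite ler_norml => /andP[_]; lra.
Qed.

(** Fixing the component [a] leaves a sphere of squared radius [eps ^+ 2 - a ^+ 2] in
    the orthogonal complement, in which the vertices of a hypercube are inscribed. *)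
Lemma cap_frame d (that : 'rV[R]_d.+2) (eps r a : R) : that != 0 -> 0 <= eps ->
  0 <= r -> height that eps r <= a -> `|a| <= eps ->
  let b2 := (eps ^+ 2 - a ^+ 2) / d.+1%:R in
  exists theta : {ffun 'I_d.+1 -> bool} -> 'rV[R]_d.+2,
    [/\ forall f, cap that eps r (theta f),
        forall f, dot (direction that) (theta f) = a &
        forall f g, dot (theta f) (theta g) =
          a ^+ 2 + b2 * \sum_i (-1) ^+ f i * (-1) ^+ g i].
Proof.
move=> that0 e0 r0 ha ae b2.
have b20 : 0 <= b2.
  by rewrite divr_ge0// subr_ge0 -(real_normK (num_real a)) ler_sqr ?nnegrE.
have [u uE u1] : exists2 u, u = direction that & dot u u = 1.
  by exists (direction that) => //; exact: direction_unit.
have [v [uv vv]] := sign_frame u1.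
have [q q2] : exists q, q * q = b2 by exists (Num.sqrt b2); rewrite -expr2 sqr_sqrtr.
pose theta f := a *: u + q *: v f.
have utheta f : dot u (theta f) = a by rewrite dotDr !dotZr u1 uv; ring.
have dtheta f g : dot (theta f) (theta g) =
    a ^+ 2 + b2 * \sum_i (-1) ^+ f i * (-1) ^+ g i.
  rewrite /theta !dotDl !dotDr !dotZl !dotZr u1 uv (dotC _ u) uv vv.
  by rewrite -q2; ring.
exists theta; split => // f; rewrite -?uE//.
apply: capP => //; last by rewrite -uE utheta.
rewrite /norm2 dtheta sum_signs /b2 divfK ?pnatr_eq0// subrKC sqrtr_sqr.
by rewrite ger0_norm.
Qed.

Section infima.
Variables (d : nat) (that : 'rV[R]_d) (eps r : R).
Hypotheses (that0 : that != 0) (e0 : 0 < eps) (r0 : 0 <= r).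
Hypotheses (d0 : (0 < d)%N) (cap0 : cap that eps r !=set0).

Lemma gap_attained : exists2 theta, cap that eps r theta &
  `|dot (direction that) theta| = gap that eps r.
Proof.
have e0' := ltW e0; have [theta0 ct0] := cap0.
have he : height that eps r <= eps by apply/cap_nonempty.
case: (eqVneq d 1%N) => [d1|d1].
  exists theta0 => //; apply/le_anti/andP; split; last exact: gap_le (cap_H1 ct0).
  apply: le_trans (normr_dot_direction_le _ _) _ => //; case: ct0 => /= -> _.
  by rewrite /gap; case: eqP.
rewrite /gap (negbTE d1).
case: d that that0 cap0 d0 d1 he {theta0 ct0} => [//|[//|d']] that' that0' _ _ _ he.
have [||theta [ct dt _]] :=
  @cap_frame d' that' eps r (Num.max 0 (height that' eps r)) that0' e0' r0.
- by rewrite le_max lexx orbT.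
- by rewrite ger0_norm ?le_max ?lexx// ge_max e0' he.
exists (theta [ffun=> true]) => //.
by rewrite dt ger0_norm// le_max lexx.
Qed.

Lemma gap_ge0_le : 0 <= gap that eps r <= eps.
Proof.
have [theta ct <-] := gap_attained; rewrite normr_ge0/=.
by case: ct => /= <- _; exact: normr_dot_direction_le.
Qed.

Lemma gamma_starE : gamma_star that eps r = gap that eps r.
Proof.
have /andP[g0 _] := gap_ge0_le.
rewrite /gamma_star; set S := [set _ | theta in _].
have -> : inf S = gap that eps r ^+ 2.
  have lbS : lbound S (gap that eps r ^+ 2).
    move=> _ [theta ct <-]; rewrite norm2_proj_line// ler_sqr ?nnegrE//.
    by apply: gap_le (cap_H1 ct) => //; exact: ltW.
  have [theta ct gt] := gap_attained.
  have Sg : S (gap that eps r ^+ 2).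
    by exists theta => //; rewrite norm2_proj_line// gt.
  apply/le_anti/andP; split.
    by apply: ge_inf => //; exists (gap that eps r ^+ 2).
  by apply: lb_le_inf => //; exists (gap that eps r ^+ 2).
by rewrite sqrtr_sqr ger0_norm.
Qed.

Lemma CSE : CS that eps r = gap that eps r / eps.
Proof.
rewrite /CS; set S := [set _ | theta in _].
have lbS : lbound S (gap that eps r / eps).
  move=> _ [theta ct <-]; rewrite cos_sim_proj_line//.
  have [-> _] : norm2 theta = eps /\ True by case: ct.
  by rewrite ler_pM2r ?invr_gt0//; apply: gap_le (cap_H1 ct) => //; exact: ltW.
have [theta ct gt] := gap_attained.
have Sg : S (gap that eps r / eps).
  exists theta => //; rewrite cos_sim_proj_line// gt.
  by have [-> _] : norm2 theta = eps /\ True by case: ct.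
apply/le_anti/andP; split.
  by apply: ge_inf => //; exists (gap that eps r / eps).
by apply: lb_le_inf => //; exists (gap that eps r / eps).
Qed.

End infima.

End geometry.

(** * Impossibility *)

Section prior.
Context {R : realType}.
Implicit Types (n d : nat).

(** From [1 - x <= expR (- x)], because [(1 + x + 2 * x ^+ 2) * (1 - x)] is at least
    one. *)
Lemma expR_le_quadratic (x : R) : x <= 2^-1 -> expR x <= 1 + x + 2 * x ^+ 2.
Proof.
move=> x2; have e0 := expR_gt0 (- x).
rewrite -[expR x]mul1r -(ler_pM2r e0) -mulrA -expRD subrr expR0 mulr1.
have := expR_ge1Dx (- x); set y := expR (- x) in e0 * => ge.
apply: le_trans (_ : 1 <= (1 + x + 2 * x ^+ 2) * (1 - x)) _.
  rewrite (_ : _ * _ = 1 + x ^+ 2 * (1 - 2 * x)); last by ring.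
  by rewrite lerDl mulr_ge0 ?sqr_ge0//; lra.
apply: ler_wpM2l => //.
have -> : 1 + x + 2 * x ^+ 2 = (1 + 2 * x) ^+ 2 / 2 + 2^-1 - x by field.
by have := sqr_ge0 (1 + 2 * x); lra.
Qed.

(** The linear terms of the two exponentials cancel; this cancellation is what
    improves the rate from [eps ^- 2] to [sqrt d * eps ^- 2]. *)
Lemma cosh_le (k : R) : `|k| <= 2^-1 ->
  expR k + expR (- k) <= 2 * expR (2 * k ^+ 2).
Proof.
rewrite ler_norml => /andP[k1 k2].
have := expR_le_quadratic k2.
have : expR (- k) <= 1 + - k + 2 * (- k) ^+ 2 by apply: expR_le_quadratic; lra.
by have := expR_ge1Dx (2 * k ^+ 2); rewrite sqrrN; lra.
Qed.

(** The exponential factors over the coordinates, and flipping the signs of [g] by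
    those of [f] shows that each factor is the same for all [f]. *)
Lemma sum_signs_expR d (k : R) :
  \sum_(f : {ffun 'I_d -> bool}) \sum_(g : {ffun 'I_d -> bool})
    expR (k * \sum_i (-1) ^+ f i * (-1) ^+ g i) =
  (expR k + expR (- k)) ^+ d * #|{ffun 'I_d -> bool}|%:R.
Proof.
rewrite (eq_bigr (fun=> (expR k + expR (- k)) ^+ d)) => [|f _].
  by rewrite sumr_const mulr_natr.
rewrite (eq_bigr (fun g : {ffun 'I_d -> bool} =>
    \prod_i expR (k * ((-1) ^+ f i * (-1) ^+ g i)))) => [|g _]; last first.
  by rewrite mulr_sumr expR_sum.
rewrite -(bigA_distr_bigA
  (fun i (b : bool) => expR (k * ((-1) ^+ f i * (-1) ^+ b)))).
rewrite (eq_bigr (fun=> expR k + expR (- k))) ?prodr_const ?card_ord// => i _.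
rewrite big_bool; case: (f i) => /=;
  by rewrite !(expr0, expr1, mulN1r, mulrN1, mul1r, mulr1, opprK) // addrC.
Qed.

Lemma sign_prior_chi2 n d (a2 b2 C : R) :
  n%:R * a2 <= C -> n%:R * b2 <= 2^-1 -> 0 <= b2 ->
  \sum_(f : {ffun 'I_d -> bool}) \sum_(g : {ffun 'I_d -> bool})
    expR (n%:R * (a2 + b2 * \sum_i (-1) ^+ f i * (-1) ^+ g i)) <=
  expR (C + 2 * (n%:R * b2) ^+ 2 * d%:R) * #|{ffun 'I_d -> bool}|%:R ^+ 2.
Proof.
move=> aC k2 b0; have k0 : 0 <= n%:R * b2 by rewrite mulr_ge0.
have [k kE] : exists k, k = n%:R * b2 by exists (n%:R * b2).
rewrite -kE in k2 k0 *.
have -> : \sum_(f : {ffun 'I_d -> bool}) \sum_(g : {ffun 'I_d -> bool})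
    expR (n%:R * (a2 + b2 * \sum_i (-1) ^+ f i * (-1) ^+ g i)) =
    expR (n%:R * a2) * \sum_(f : {ffun 'I_d -> bool}) \sum_(g : {ffun 'I_d -> bool})
    expR (k * \sum_i (-1) ^+ f i * (-1) ^+ g i).
  rewrite mulr_sumr; apply: eq_bigr => f _; rewrite mulr_sumr.
  by apply: eq_bigr => g _; rewrite -expRD mulrDr mulrA -kE.
rewrite sum_signs_expR card_ffun card_bool card_ord natrX.
rewrite (expr2 (2 ^+ d)) !mulrA; apply: ler_wpM2r; first exact: exprn_ge0.
rewrite expRD -mulrA.
apply: ler_pM; rewrite ?expR_ge0 ?ler_expR ?exprn_ge0 ?addr_ge0 ?expR_ge0//.
rewrite [_ * d%:R]mulrC expRM_natl [leRHS]mulrC -exprMn.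
apply: lerXn2r; rewrite ?nnegrE ?addr_ge0 ?mulr_ge0 ?expR_ge0//.
by rewrite -mulrA -expr2; apply: cosh_le; rewrite ger0_norm.
Qed.

End prior.

Section lower_bounds.
Context {R : realType}.
Variables (alpha beta : R).
Hypotheses (ha : 0 < alpha < 1) (hb : 0 < beta < 1 - alpha).

Let delta := 1 - alpha - beta.
(** Small enough that [expR_chi2_le] holds and that the argument of the hyperbolic
    cosine in [not_powerful_cap] stays below one half. *)
Definition necessary_const : R := (1 - alpha - beta) ^+ 2 / 32.

Let dl0 : 0 < delta.
Proof. by move: ha hb => /andP[? ?] /andP[? ?]; rewrite /delta; lra. Qed.

Let dl1 : delta < 1.
Proof. by move: ha hb => /andP[? ?] /andP[? ?]; rewrite /delta; lra. Qed.

Let necessary_constE : necessary_const = delta ^+ 2 / 32. Proof. by []. Qed.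

Lemma necessary_const_gt0 : 0 < necessary_const.
Proof. by rewrite necessary_constE divr_gt0 ?exprn_gt0. Qed.

Lemma necessary_const_small : necessary_const <= 32^-1.
Proof.
have : delta ^+ 2 <= 1 by rewrite exprn_ile1// ltW.
by rewrite necessary_constE; lra.
Qed.

(** The bound on [x] is the exponent that [sign_prior_chi2] yields under the
    assumptions of [not_powerful_cap]. *)
Lemma expR_chi2_le x : x <= necessary_const + 64 * necessary_const ^+ 2 ->
  expR x <= 1 + delta ^+ 2.
Proof.
move=> xC; have C0 := necessary_const_gt0; have Cs := necessary_const_small.
have y0 : 0 <= necessary_const + 64 * necessary_const ^+ 2 by nra.
have y2 : necessary_const + 64 * necessary_const ^+ 2 <= 3 * necessary_const by nra.
have -> : delta ^+ 2 = 32 * necessary_const by rewrite necessary_constE; field.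
apply: le_trans (_ : expR (3 * necessary_const) <= _).
  by rewrite ler_expR; lra.
by apply: le_trans (expR_le_quadratic _) _; nra.
Qed.

Lemma not_powerful_point n d (that theta : 'rV[R]_d) eps r : (0 < n)%N ->
  H1 that eps r theta -> n%:R * dot theta theta <= necessary_const ->
  forall psi : {mfun 'rV[R]_d >-> bool},
    valid alpha n psi -> ~ powerful beta n that eps r psi.
Proof.
move=> n0 Ht small; have C0 := necessary_const_gt0.
apply: (@not_powerful _ unit n d (fun=> theta)) => //.
- by rewrite card_unit.
- by case/andP: hb.
- rewrite !sumr_const card_unit mulr1n expr1n mulr1.
  by apply: expR_chi2_le; nra.
Qed.

(** In dimension one the gap is [eps] and a single point of the cap suffices.
    Otherwise the points of [cap_frame] at the smallest component are used: then
    [n * b2] is at most [n * eps ^+ 2 / (d - 1)], whose square times [d - 1] is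
    bounded by a multiple of [necessary_const ^+ 2]. *)
Lemma not_powerful_cap n d (that : 'rV[R]_d) eps r : (0 < n)%N -> (0 < d)%N ->
  that != 0 -> 0 < eps -> 0 <= r -> cap that eps r !=set0 ->
  n%:R * gap that eps r ^+ 2 <= necessary_const ->
  n%:R * eps ^+ 2 <= 4 * necessary_const * Num.sqrt d%:R ->
  forall psi : {mfun 'rV[R]_d >-> bool},
    valid alpha n psi -> ~ powerful beta n that eps r psi.
Proof.
move=> n0 d0 that0 e0 r0 cap0 ng ne.
have C0 := necessary_const_gt0; have Cs := necessary_const_small.
case: (eqVneq d 1%N) => [d1|d1].
  have [theta ct] := cap0; apply: (@not_powerful_point _ _ _ theta) => //.
    exact: cap_H1.
  move: ng; rewrite /gap; case: eqP => // _; rewrite -norm2_sqr.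
  by case: ct => /= ->.
have he : height that eps r <= eps by apply/cap_nonempty => //; exact: ltW.
move: ng; rewrite /gap (negbTE d1); set a := Num.max 0 _ => na.
case: d that that0 d0 d1 he @a na ne {cap0} => [//|[//|d]] that that0 _ _ he a na ne.
have a0 : 0 <= a by rewrite le_max lexx.
have ae : `|a| <= eps by rewrite ger0_norm// ge_max he ltW.
have ha' : height that eps r <= a by rewrite le_max lexx orbT.
have [theta [ct _ dt]] := cap_frame that0 (ltW e0) r0 ha' ae.
set b2 := (eps ^+ 2 - a ^+ 2) / d.+1%:R in dt.
have D0 : 0 < d.+1%:R :> R by rewrite ltr0n.
have D1 : 1 <= d.+1%:R :> R by rewrite ler1n.
have b0 : 0 <= b2.
  rewrite divr_ge0// subr_ge0 ler_sqr ?nnegrE ?a0 ?(ltW e0)//.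
  by rewrite -(ger0_norm a0).
have nn : 0 < n%:R :> R by rewrite ltr0n.
have k0 : 0 <= n%:R * b2 by rewrite mulr_ge0.
have kD : n%:R * b2 * d.+1%:R <= n%:R * eps ^+ 2.
  rewrite -mulrA /b2 divfK ?gt_eqF//.
  by apply: ler_wpM2l; rewrite ?(ltW nn)// gerBl sqr_ge0.
have sqrtd : Num.sqrt d.+2%:R ^+ 2 = d.+1%:R + 1 :> R.
  by rewrite sqr_sqrtr// -natr1.
have k2D : (n%:R * b2) ^+ 2 * d.+1%:R <= 32 * necessary_const ^+ 2.
  have le : (n%:R * b2 * d.+1%:R) ^+ 2 <=
      (4 * necessary_const * Num.sqrt d.+2%:R) ^+ 2.
    rewrite ler_sqr ?nnegrE; first exact: le_trans kD ne.
    - by rewrite mulr_ge0// ltW.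
    - by rewrite mulr_ge0 ?sqrtr_ge0// mulr_ge0// ltW.
  rewrite -(ler_pM2r D0) -mulrA -expr2 -exprMn; apply: le_trans le _.
  rewrite exprMn sqrtd; have := exprn_gt0 2 C0; nra.
have k2 : n%:R * b2 <= 2^-1.
  have := exprn_gt0 2 C0.
  have : (n%:R * b2) ^+ 2 <= 2^-1 ^+ 2; last first.
    by rewrite ler_sqr ?nnegrE ?invr_ge0.
  nra.
apply: (@not_powerful _ _ n _ theta) => //.
- by apply/card_gt0P; exists [ffun=> true].
- by case/andP: hb.
- by move=> f; exact: cap_H1.
under eq_bigr do under eq_bigr do rewrite dt.
have chi := @sign_prior_chi2 R n d.+1 (a ^+ 2) b2 necessary_const na k2 b0.
apply: le_trans chi _.
apply: ler_wpM2r; first exact: sqr_ge0.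
by apply: expR_chi2_le; lra.
Qed.

End lower_bounds.

(** * Sufficiency *)

Section upper_bounds.
Context {R : realType}.
Variables (alpha beta : R).
Hypotheses (ha : 0 < alpha < 1) (hb : 0 < beta < 1 - alpha).

Definition linear_const : R := 1 - ln (alpha / 2) - ln (beta / 2).
Definition quadratic_const : R := 3 - 6 * ln alpha - 6 * ln (beta / 2).
(** The sum dominates both requirements: [quadratic_test] asks for
    [quadratic_const], and [linear_test], once squared, for [linear_const ^+ 2]. *)
Definition sufficient_const : R := quadratic_const + linear_const ^+ 2.

Let b2_gt0 : 0 < beta / 2.
Proof. by move: hb => /andP[? ?]; lra. Qed.

Lemma linear_const_gt0 : 0 < linear_const.
Proof.
move: ha hb => /andP[? ?] /andP[? ?].
have : ln (alpha / 2) < 0 by apply: ln_lt0; lra.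
have : ln (beta / 2) < 0 by apply: ln_lt0; lra.
by rewrite /linear_const; lra.
Qed.

Lemma quadratic_const_gt0 : 0 < quadratic_const.
Proof.
move: ha hb => /andP[? ?] /andP[? ?].
have : ln alpha < 0 by apply: ln_lt0; lra.
have : ln (beta / 2) < 0 by apply: ln_lt0; lra.
by rewrite /quadratic_const; lra.
Qed.

Lemma sufficient_const_gt0 : 0 < sufficient_const.
Proof.
have := quadratic_const_gt0; have := sqr_ge0 linear_const.
by rewrite /sufficient_const; lra.
Qed.

(** Aiming at half of [beta] makes the inequality strict for the supremum. *)
Lemma powerful_of_law_le n d (that : 'rV[R]_d) eps r
    (psi : {mfun 'rV[R]_d >-> bool}) :
  (forall theta, H1 that eps r theta ->
    (law n theta [set x | psi x = false] <= (beta / 2)%:E)%E) ->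
  powerful beta n that eps r psi.
Proof.
move=> H; apply: (@le_lt_trans _ _ (beta / 2)%:E).
  by apply: ge_ereal_sup => _ [theta Ht <-]; exact: H.
by rewrite lte_fin; move: hb => /andP[? ?]; lra.
Qed.

Lemma linear_power n d (that : 'rV[R]_d) eps r (G : R) : (0 < n)%N ->
  that != 0 -> 0 < G ->
  (forall theta, H1 that eps r theta -> G <= `|dot (direction that) theta|) ->
  sufficient_const * G ^- 2 <= n%:R ->
  exists psi : {mfun 'rV[R]_d >-> bool},
    valid alpha n psi /\ powerful beta n that eps r psi.
Proof.
move=> n0 that0 G0 GH; rewrite ler_pdivrMr ?exprn_gt0// => Cn.
have [a0 _] := andP ha.
have [psi [val pow]] := linear_test a0 b2_gt0 n0 (direction_unit that0).
exists psi; split => //; apply: powerful_of_law_le => theta /GH le; apply: pow.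
apply: le_trans (_ : Num.sqrt n%:R * G <= _); last by apply: ler_wpM2l le.
rewrite -/linear_const -[leRHS]ger0_norm ?mulr_ge0 ?(ltW G0)//.
rewrite -[leLHS]ger0_norm ?(ltW linear_const_gt0)//.
rewrite -ler_sqr ?nnegrE ?normr_ge0// !real_normK ?num_real// exprMn sqr_sqrtr//.
by apply: le_trans Cn; rewrite /sufficient_const; have := quadratic_const_gt0; lra.
Qed.

Lemma quadratic_power n d (that : 'rV[R]_d) eps r : (0 < n)%N -> (0 < d)%N ->
  0 < eps -> sufficient_const * (Num.sqrt d%:R * eps ^- 2) <= n%:R ->
  exists psi : {mfun 'rV[R]_d >-> bool},
    valid alpha n psi /\ powerful beta n that eps r psi.
Proof.
move=> n0 d0 e0; rewrite mulrA ler_pdivrMr ?exprn_gt0// => Cn.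
have [a0 _] := andP ha.
have [psi [val pow]] := quadratic_test a0 b2_gt0 n0 d0.
exists psi; split => //; apply: powerful_of_law_le => theta [et _]; apply: pow.
rewrite -/quadratic_const.
apply: le_trans (_ : sufficient_const * Num.sqrt d%:R <= _).
  apply: ler_wpM2r => //; have := sqr_ge0 linear_const.
  by rewrite /sufficient_const; lra.
apply: le_trans Cn _; apply: ler_wpM2l => //.
by rewrite -norm2_sqr ler_sqr ?nnegrE ?norm2_ge0 ?(ltW e0).
Qed.

End upper_bounds.

(** * Regimes *)

Section regimes.
Context {R : realType}.
Implicit Types (d : nat) (eps r : R) (k : regime).

(** The factor [2^-1] is smaller than one, so that dimension one, where [CS] is one,
    never belongs to the first regime. *)
Definition threshold d : R := 2^-1 * d%:R `^ (- 4^-1).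

Lemma threshold_gt0 d : (0 < d)%N -> 0 < threshold d.
Proof. by move=> d0; rewrite mulr_gt0// powR_gt0// ltr0n. Qed.

Lemma threshold_sqr d : (0 < d)%N -> threshold d ^+ 2 = 4^-1 / Num.sqrt d%:R.
Proof.
move=> d0; rewrite exprMn -(powR_mulrn 2 (powR_ge0 d%:R _)) -powRrM.
have -> : - 4^-1 * 2%:R = - 2^-1 :> R by field.
by rewrite powRN powR12_sqrt//; congr (_ / _); field.
Qed.

Lemma threshold_sqr_sqrt d : (0 < d)%N -> threshold d ^+ 2 * Num.sqrt d%:R = 4^-1.
Proof.
by move=> d0; rewrite threshold_sqr// divfK// gt_eqF// sqrtr_gt0 ltr0n.
Qed.

Lemma threshold_le d : (0 < d)%N -> threshold d <= 2^-1.
Proof.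
move=> d0; rewrite -ler_sqr ?nnegrE ?(ltW (threshold_gt0 d0))// threshold_sqr//.
rewrite ler_pdivrMr ?sqrtr_gt0 ?ltr0n//.
have : Num.sqrt 1 <= Num.sqrt d%:R :> R by apply: ler_wsqrtr; rewrite ler1n.
by rewrite sqrtr1; lra.
Qed.

Lemma diffuseE d (that : 'rV[R]_d) eps r : (0 < d)%N ->
  in_regime 2^-1 Diffuse that eps r ->
  [/\ admissible that eps r, cap that eps r !=set0 &
      gap that eps r <= threshold d * eps].
Proof.
move=> d0 [adm [CSt cap0]]; have [that0 e0 r0 _] := adm; split => //.
by move: CSt; rewrite CSE// ler_pdivrMr.
Qed.

Lemma alignedE d (that : 'rV[R]_d) eps r : (0 < d)%N ->
  in_regime 2^-1 Aligned that eps r ->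
  [/\ admissible that eps r, cap that eps r !=set0 &
      threshold d * eps <= gap that eps r].
Proof.
move=> d0 [adm [/andP[CSt _] cap0]]; have [that0 e0 r0 _] := adm; split => //.
by move: CSt; rewrite CSE// ler_pdivlMr.
Qed.

Lemma norm2_continuous d : continuous (@norm2 R d).
Proof.
move=> x; apply: continuous_comp; last exact: sqrt_continuous.
apply: (@continuous_big _ _ _ _ _ _ _ _
  (fun i (y : 'rV[R]_d) => y ord0 i * y ord0 i)).
  exact: add_continuous.
move=> i _ y; have cc := @coord_continuous R 1 d ord0 i y.
exact: (cvgM cc cc).
Qed.

(** The closures of the regimes are used only through the weak inequalities between
    continuous functions that they inherit. *)
Lemma closure_ge0 (T : topologicalType) (A : set T) (f : T -> R) p :
  continuous f -> (forall q, A q -> 0 <= f q) -> closure A p -> 0 <= f p.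
Proof.
move=> cf Af clA; rewrite leNgt; apply/negP => fp.
have [q [Aq fq]] := clA _ (cvgr_lt _ (cf p) _ fp).
by have := Af q Aq; rewrite leNgt fq.
Qed.

(** The difference [height - c * eps] multiplied by [2 * norm2 that], which is
    continuous also where the prediction vanishes. *)
Definition slack d (c : R) (p : 'rV[R]_d * R * R) : R :=
  norm2 p.1.1 ^+ 2 + p.1.2 ^+ 2 - p.2 ^+ 2 - c * (2 * norm2 p.1.1) * p.1.2.

Lemma slackE d (that : 'rV[R]_d) eps r c : that != 0 ->
  slack c (that, eps, r) = (height that eps r - c * eps) * (2 * norm2 that).
Proof.
move=> that0; rewrite /slack /height /=; field.
by rewrite gt_eqF// norm2_gt0.
Qed.

Lemma norm2_fst_continuous d :
  continuous (fun p : 'rV[R]_d * R * R => norm2 p.1.1).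
Proof.
move=> p; apply: (continuous_comp (f := fun p : 'rV[R]_d * R * R => p.1.1)).
  apply: (continuous_comp (f := fst)); exact: cvg_fst.
exact: norm2_continuous.
Qed.

Lemma slack_continuous d c : continuous (@slack d c).
Proof.
move=> p; have n1 := @norm2_fst_continuous d p.
have e1 : {for p, continuous (fun p : 'rV[R]_d * R * R => p.1.2)}.
  by apply: (continuous_comp (f := fst)); [exact: cvg_fst|exact: cvg_snd].
have r1 : {for p, continuous (fun p : 'rV[R]_d * R * R => p.2)} by exact: cvg_snd.
apply: cvgB; first apply: cvgB; first apply: cvgD.
- exact: (cvgM n1 n1).
- exact: (cvgM e1 e1).
- exact: (cvgM r1 r1).
- apply: cvgM; last exact: e1.
  apply: cvgM; first exact: cvg_cst.
  by apply: cvgM; [exact: cvg_cst|exact: n1].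
Qed.

End regimes.

Section transitions.
Context {R : realType}.
Variable d : nat.
Hypothesis d0 : (0 < d)%N.
Implicit Types (that : 'rV[R]_d) (eps r : R) (k : regime).
Local Notation t := (@threshold R d).

Lemma height_le_slack that eps r c : that != 0 -> 0 <= - slack c (that, eps, r) ->
  height that eps r <= c * eps.
Proof.
move=> that0; rewrite slackE// oppr_ge0 pmulr_lle0 ?subr_le0//.
by rewrite mulr_gt0 ?norm2_gt0.
Qed.

Lemma height_ge_slack that eps r c : that != 0 -> 0 <= slack c (that, eps, r) ->
  c * eps <= height that eps r.
Proof.
move=> that0; rewrite slackE// pmulr_lge0 ?subr_ge0//.
by rewrite mulr_gt0 ?norm2_gt0.
Qed.

Lemma slackN_ge0 that eps r c : that != 0 -> height that eps r <= c * eps ->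
  0 <= - slack c (that, eps, r).
Proof.
move=> that0 h; rewrite slackE// oppr_ge0 pmulr_lle0 ?subr_le0//.
by rewrite mulr_gt0 ?norm2_gt0.
Qed.

Lemma slack_ge0 that eps r c : that != 0 -> c * eps <= height that eps r ->
  0 <= slack c (that, eps, r).
Proof.
move=> that0 h; rewrite slackE// pmulr_lge0 ?subr_ge0//.
by rewrite mulr_gt0 ?norm2_gt0.
Qed.

Lemma slackN_continuous c : continuous (fun p : 'rV[R]_d * R * R => - slack c p).
Proof. by move=> p; apply: cvgN; exact: slack_continuous. Qed.

(** In dimension one the regime is empty, hence so is its closure. *)
Lemma closure_diffuse that eps r : that != 0 ->
  closure (regime_set 2^-1 Diffuse (d:=d)) (that, eps, r) ->
  d != 1%N /\ height that eps r <= t * eps.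
Proof.
move=> that0 cl; have t1 : t < 1 by apply: le_lt_trans (threshold_le d0) _; lra.
have d1 : d != 1%N.
  have [[[th e] r'] [/= Hq _]] := cl _ filterT.
  have [[_ e0 _ _] _] := diffuseE d0 Hq; rewrite /gap; case: eqP => // _.
  by nra.
split => //; apply: height_le_slack => //.
have := closure_ge0 (slackN_continuous (c := t)) _ cl; apply.
move=> [[th e] r'] /= Hq; have [[th0 e0 _ _] _ g] := diffuseE d0 Hq.
apply: slackN_ge0 => //; apply: le_trans g.
by rewrite /gap (negbTE d1) le_max lexx orbT.
Qed.

Lemma closure_aligned that eps r : that != 0 ->
  closure (regime_set 2^-1 Aligned (d:=d)) (that, eps, r) ->
  height that eps r <= eps /\ (d != 1%N -> t * eps <= height that eps r).
Proof.
move=> that0 cl; split=> [|d1].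
  rewrite -[leRHS]mul1r; apply: height_le_slack => //.
  have := closure_ge0 (slackN_continuous (c := 1)) _ cl; apply.
  move=> [[th e] r'] /= Hq; have [[th0 e0 r0 _] c0 g] := alignedE d0 Hq.
  by apply: slackN_ge0 => //; rewrite mul1r; apply/cap_nonempty => //; exact: ltW.
apply: height_ge_slack => //.
have := closure_ge0 (slack_continuous (c := t)) _ cl; apply.
move=> [[th e] r'] /= Hq; have [[th0 e0 r0 _] c0] := alignedE d0 Hq.
rewrite /gap (negbTE d1) le_max => /orP[|]; last exact: slack_ge0.
by have := mulr_gt0 (@threshold_gt0 R _ d0) e0; lra.
Qed.

Lemma closure_separated that eps r :
  closure (regime_set 2^-1 Separated (d:=d)) (that, eps, r) ->
  eps <= norm2 that - r.
Proof.
move=> cl; rewrite -subr_ge0.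
apply: (@closure_ge0 _ _ _
  (fun p : 'rV[R]_d * R * R => norm2 p.1.1 - p.2 - p.1.2) _ _ _ cl).
  move=> p; apply: cvgB; first apply: cvgB.
  - exact: norm2_fst_continuous.
  - exact: cvg_snd.
  - by apply: (continuous_comp (f := fst)); [exact: cvg_fst|exact: cvg_snd].
move=> [[th e] r'] [adm /= c0]; rewrite subr_ge0; apply/ltW.
exact/separatedE.
Qed.

Lemma rate_aligned that eps r : admissible that eps r -> cap that eps r !=set0 ->
  rate Aligned that eps r = gap that eps r ^- 2.
Proof. by move=> [that0 e0 r0 _] c0; rewrite /= gamma_starE. Qed.

Lemma rate_separated that eps r : admissible that eps r -> eps <= norm2 that - r ->
  rate Separated that eps r = (norm2 that - r) ^- 2.
Proof.
by move=> [that0 e0 r0 _] le; rewrite /= norm2_theta_star//; lra.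
Qed.

(** Both closures together force the height to be [threshold d * eps]; the factor is
    the inverse square of the constant in the threshold. *)
Lemma transition_diffuse_aligned that eps r :
  transition 2^-1 Diffuse Aligned that eps r ->
  rate Aligned that eps r = 4 * rate Diffuse that eps r.
Proof.
move=> [adm [clD clA]]; have [that0 e0 r0 _] := adm.
have [d1 h1] := closure_diffuse that0 clD.
have [h2 /(_ d1) h3] := closure_aligned that0 clA.
have t0 := @threshold_gt0 R _ d0.
have c0 : cap that eps r !=set0 by apply/cap_nonempty => //; exact: ltW.
rewrite rate_aligned//.
have -> : gap that eps r = t * eps.
  rewrite /gap (negbTE d1).
  rewrite (_ : height that eps r = t * eps); last exact/le_anti/andP.
  by apply/max_idPr; rewrite mulr_ge0// ltW.
rewrite /= exprMn threshold_sqr//.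
have sd : Num.sqrt d%:R != 0 :> R by rewrite gt_eqF// sqrtr_gt0 ltr0n.
by field; rewrite sd gt_eqF.
Qed.

(** Here the ball touches the sphere from outside: [norm2 that - r = eps], the cap is
    the single point [eps *: direction that], and it is the point of smallest
    norm. *)
Lemma transition_aligned_separated that eps r :
  transition 2^-1 Aligned Separated that eps r ->
  rate Aligned that eps r = rate Separated that eps r.
Proof.
move=> [adm [clA clS]]; have [that0 e0 r0 _] := adm.
have [h1 _] := closure_aligned that0 clA.
have sep := closure_separated clS.
have c0 : cap that eps r !=set0 by apply/cap_nonempty => //; exact: ltW.
have eN : norm2 that - r = eps.
  by move: h1; rewrite height_le// ler_norml => /andP[_ ?]; apply/le_anti; lra.
rewrite rate_aligned// rate_separated// eN; congr (_ ^- 2).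
rewrite /gap; case: eqP => // _.
have -> : height that eps r = eps; last by apply/max_idPr/ltW.
rewrite /height (_ : r = norm2 that - eps); last by rewrite -eN subKr.
by field; rewrite gt_eqF// norm2_gt0.
Qed.

(** The three rates are compared with [eps] only, which is common to both sides:
    [gamma_star] lies between [threshold d * eps] and [eps] in the second regime, and
    the point of smallest norm lies beyond [eps] in the third. *)
Lemma rate_ordered eps that that' r r' k k' :
  [\/ (k, k') = (Diffuse, Aligned), (k, k') = (Aligned, Separated)
         | (k, k') = (Diffuse, Separated)] ->
  in_regime 2^-1 k that eps r -> in_regime 2^-1 k' that' eps r' ->
  rate k' that' eps r' <= 4 * rate k that eps r.
Proof.
have t0 := @threshold_gt0 R _ d0; have tS := @threshold_sqr_sqrt R _ d0.
have sd1 : 1 <= Num.sqrt d%:R :> R.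
  have : Num.sqrt 1 <= Num.sqrt d%:R :> R by apply: ler_wsqrtr; rewrite ler1n.
  by rewrite sqrtr1.
have sd0 : 0 < Num.sqrt d%:R :> R by lra.
move=> [] [-> ->].
- move=> [[_ e0 _ _] _] /alignedE-/(_ d0) [adm c0 g]; rewrite rate_aligned//=.
  have te := mulr_gt0 t0 e0; have g0 := lt_le_trans te g.
  have tg : (t * eps) ^+ 2 <= gap that' eps r' ^+ 2.
    by rewrite ler_sqr ?nnegrE ?(ltW te) ?(ltW g0).
  rewrite mulrA ler_pdivlMr ?exprn_gt0// mulrC ler_pdivrMr ?exprn_gt0//.
  rewrite exprMn in tg.
  have -> : eps ^+ 2 = 4 * Num.sqrt d%:R * (t ^+ 2 * eps ^+ 2).
    transitivity (4 * (t ^+ 2 * Num.sqrt d%:R) * eps ^+ 2); last by ring.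
    by rewrite tS; field.
  by apply: ler_wpM2l => //; rewrite mulr_ge0 ?sqrtr_ge0.
- move=> /alignedE-/(_ d0) [adm c0 g] [adm' /(separatedE adm') sep].
  rewrite rate_aligned// rate_separated ?(ltW sep)//.
  have [that0 e0 r0 _] := adm.
  have te := mulr_gt0 t0 e0; have g0 := lt_le_trans te g.
  have /andP[_ ge] := gap_ge0_le that0 e0 r0 d0 c0.
  have M0 := lt_trans e0 sep.
  apply: le_trans (_ : gap that eps r ^- 2 <= _).
    rewrite lef_pV2 ?posrE ?exprn_gt0//.
    by rewrite ler_sqr ?nnegrE ?(ltW g0) ?(ltW M0)//; lra.
  by have : 0 < gap that eps r ^- 2 by [rewrite invr_gt0 exprn_gt0]; lra.
- move=> [[_ e0 _ _] _] [adm' /(separatedE adm') sep].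
  rewrite rate_separated ?(ltW sep)//=; have M0 := lt_trans e0 sep.
  apply: le_trans (_ : eps ^- 2 <= _).
    rewrite lef_pV2 ?posrE ?exprn_gt0//.
    by rewrite ler_sqr ?nnegrE ?(ltW e0) ?(ltW M0)//; lra.
  rewrite mulrA ler_peMl ?invr_ge0 ?sqr_ge0//; lra.
Qed.

End transitions.

(** * The testing rate *)

Section testing_rate.
Context {R : realType}.
Variables (alpha beta : R).
Hypotheses (ha : 0 < alpha < 1) (hb : 0 < beta < 1 - alpha).
Variables (d n : nat) (that : 'rV[R]_d) (eps r : R).
Hypotheses (d0 : (0 < d)%N) (n0 : (0 < n)%N).

Let nn : 0 < n%:R :> R. Proof. by rewrite ltr0n. Qed.
Let sd : 0 < Num.sqrt d%:R :> R. Proof. by rewrite sqrtr_gt0 ltr0n. Qed.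

Lemma rate_sufficient k : in_regime 2^-1 k that eps r ->
  sufficient_const alpha beta * rate k that eps r <= n%:R ->
  exists psi : {mfun 'rV[R]_d >-> bool},
    valid alpha n psi /\ powerful beta n that eps r psi.
Proof.
case: k => reg.
- have [[_ e0 _ _] _] := reg; exact: quadratic_power.
- have [adm c0 g] := alignedE d0 reg; rewrite rate_aligned//.
  have [that0 e0 r0 _] := adm; apply: linear_power => //.
    by apply: lt_le_trans g; rewrite mulr_gt0 ?threshold_gt0.
  by move=> theta; apply: gap_le => //; exact: ltW.
- have [adm /(separatedE adm) sep] := reg; rewrite rate_separated ?(ltW sep)//.
  have [that0 e0 r0 _] := adm; apply: linear_power => //; first exact: lt_trans sep.
  by move=> theta [_ /(ball_direction that0) le]; apply: le_trans le (ler_norm _).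
Qed.

(** In the first regime [n * eps ^+ 2] is small compared with [sqrt d] and the
    threshold bounds [n * gamma_star ^+ 2]; in the second, [n * gamma_star ^+ 2] is
    small and the threshold bounds [n * eps ^+ 2] from it. *)
Lemma rate_necessary k : in_regime 2^-1 k that eps r ->
  n%:R <= necessary_const alpha beta * rate k that eps r ->
  forall psi : {mfun 'rV[R]_d >-> bool},
    valid alpha n psi -> ~ powerful beta n that eps r psi.
Proof.
have tS := @threshold_sqr_sqrt R _ d0; have t0 := @threshold_gt0 R _ d0.
have C0 := necessary_const_gt0 ha hb; case: k => reg.
- have [adm c0 g] := diffuseE d0 reg; have [that0 e0 r0 _] := adm.
  rewrite /= mulrA ler_pdivlMr ?exprn_gt0// => ne.
  have /andP[g0 _] := gap_ge0_le that0 e0 r0 d0 c0.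
  apply: not_powerful_cap => //; last by apply: le_trans ne _; nra.
  apply: le_trans (_ : n%:R * (threshold d * eps) ^+ 2 <= _).
    apply: ler_wpM2l; first exact: ltW.
    by rewrite ler_sqr ?nnegrE// mulr_ge0 ?ltW.
  rewrite exprMn mulrCA; apply: le_trans (ler_wpM2l (sqr_ge0 _) ne) _.
  by rewrite mulrCA tS; lra.
- have [adm c0 g] := alignedE d0 reg; have [that0 e0 r0 _] := adm.
  have te := mulr_gt0 t0 e0; have g0 := lt_le_trans te g.
  rewrite rate_aligned// ler_pdivlMr ?exprn_gt0// => ng.
  apply: not_powerful_cap => //.
  have tg : (threshold d * eps) ^+ 2 <= gap that eps r ^+ 2.
    by rewrite ler_sqr ?nnegrE ?(ltW te) ?(ltW g0).
  have {}ng : n%:R * (threshold d * eps) ^+ 2 <= necessary_const alpha beta.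
    by apply: le_trans ng; apply: ler_wpM2l => //; exact: ltW.
  have -> : n%:R * eps ^+ 2 = 4 * Num.sqrt d%:R * (n%:R * (threshold d * eps) ^+ 2).
    rewrite exprMn.
    transitivity (4 * (threshold d ^+ 2 * Num.sqrt d%:R) * (n%:R * eps ^+ 2));
      last by ring.
    by rewrite tS; field.
  by rewrite mulrAC; apply: ler_wpM2r; rewrite ?ler_pM2l// ltW.
- have [adm /(separatedE adm) sep] := reg; have [that0 e0 r0 _] := adm.
  have M0 := lt_trans e0 sep; rewrite rate_separated ?(ltW sep)//.
  rewrite ler_pdivlMr ?exprn_gt0// => nM.
  have uu := direction_unit that0.
  have nN : norm2 ((norm2 that - r) *: direction that) = norm2 that - r.
    by rewrite norm2Z norm2_direction// mulr1 gtr0_norm.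
  apply: (not_powerful_point
    (theta := (norm2 that - r) *: direction that) ha hb) => //.
    split; first by rewrite nN ltW.
    by rewrite pred_ballE// -norm2_sqr nN dotZr uu; nra.
  by rewrite -norm2_sqr nN.
Qed.

End testing_rate.

Theorem theorem1 (R : realType) (alpha beta : R)
    (halpha : 0 < alpha < 1) (hbeta : 0 < beta < 1 - alpha) :
  exists c C1 C2 K : R, [/\ 0 < c, 0 < C1, 0 < C2 & 0 < K] /\
  [/\
    (* the testing rate *)
    (forall (d n : nat) (that : 'rV[R]_d) (eps r rho : R),
       (0 < d)%N -> (0 < n)%N -> admissible that eps r ->
       is_rho c that eps r rho ->
       (C1 * rho <= n%:R ->
          exists psi : {mfun 'rV[R]_d >-> bool},
            valid alpha n psi /\ powerful beta n that eps r psi) /\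
       (n%:R <= C2 * rho ->
          forall psi : {mfun 'rV[R]_d >-> bool},
            valid alpha n psi -> ~ powerful beta n that eps r psi)),
    (* agreement at the transitions between consecutive regimes *)
    (forall (d : nat) (that : 'rV[R]_d) (eps r : R) (k k' : regime),
       (0 < d)%N ->
       (k, k') = (Diffuse, Aligned) \/ (k, k') = (Aligned, Separated) ->
       transition c k k' that eps r ->
       rate k that eps r <= K * rate k' that eps r /\
       rate k' that eps r <= K * rate k that eps r)
  & (* the rates are ordered from top to bottom, for a given separation eps *)
    (forall (d : nat) (eps : R) (that that' : 'rV[R]_d) (r r' : R)
       (k k' : regime),
       (0 < d)%N ->
       [\/ (k, k') = (Diffuse, Aligned), (k, k') = (Aligned, Separated)
         | (k, k') = (Diffuse, Separated)] ->
       in_regime c k that eps r -> in_regime c k' that' eps r' ->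
       rate k' that' eps r' <= K * rate k that eps r)].
Proof.
exists 2^-1, (sufficient_const alpha beta), (necessary_const alpha beta), 4; split.
  by split; [lra|exact: sufficient_const_gt0|exact: necessary_const_gt0|lra].
split.
- move=> d n that eps r rho d0 n0 _ [k reg ->].
  by split; [exact: rate_sufficient|exact: rate_necessary].
- move=> d that eps r k k' d0 [] [-> ->] tr.
  + rewrite (transition_diffuse_aligned d0 tr).
    have : 0 <= rate Diffuse that eps r.
      by rewrite mulr_ge0 ?sqrtr_ge0// invr_ge0 sqr_ge0.
    by lra.
  + rewrite (transition_aligned_separated d0 tr).
    by have : 0 <= rate Separated that eps r by [rewrite invr_ge0 sqr_ge0]; lra.
- by move=> d eps that that' r r' k k' d0; exact: rate_ordered.
Qed.
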